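(* Let $M$ be a manifold and let $\widehat\nabla$ be a connection on the manifold $\mathbb{R}\times M$. Then there exist - a time-dependent function $\lambda$ on $M$, - time-dependent 1-forms $\alpha$ and $\beta$ on $M$, - a time-dependent 2-covariant tensor field $\varepsilon$ on $M$, - a time-dependent vector field $C$ on $M$, - time-dependent endomorphisms $A,B$ of $\mathrm{T}M$, and - a time-dependent connection $\nabla\equiv{}^t\nabla$ on $M$, such that, for any two vector fields $\widehat X=f^0\frac{\partial}{\partial t}+X$ and $\widehat Y=g^0\frac{\partial}{\partial t}+Y$ on $\mathbb{R}\times M$ (where $f^0,g^0\in C^\infty(\mathbb{R}\times M)$ and $X,Y$ are time-dependent vector fields on $M$), $$\widehat\nabla_{\widehat X}\widehat Y=\Big(f^0\dot g^0+\mathscr{L}_Xg^0+\lambda f^0g^0+\alpha(X)g^0+\beta(Y)f^0+\varepsilon(X,Y)\Big)\frac{\partial}{\partial t}+\Big(f^0\dot Y+\nabla_XY+C f^0g^0+A(X)g^0+B(Y)f^0\Big).$$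
   Context: All manifolds are smooth and paracompact, and all maps are smooth. A connection on a manifold is a linear connection on its tangent bundle (not assumed torsion-free). Let $\rho_2\colon\mathbb{R}\times M\to M$ be the projection and $t$ the coordinate of $\mathbb{R}$. A time-dependent object on $M$ (function, vector field, 1-form, tensor field, endomorphism of $\mathrm{T}M$) is a smooth one-parameter family, indexed by $t\in\mathbb{R}$, of such objects on $M$, i.e. a smooth section along $\rho_2$ of the corresponding bundle; for example a time-dependent vector field is a smooth map $X\colon\mathbb{R}\times M\to\mathrm{T}M$ with $X(t,p)\in\mathrm{T}_pM$. Through the identification $\mathrm{T}_{(t,p)}(\mathbb{R}\times M)\cong \mathrm{T}_t\mathbb{R}\oplus \mathrm{T}_pM$, time-dependent vector fields on $M$ are regarded as vector fields on $\mathbb{R}\times M$, and every vector field on $\mathbb{R}\times M$ is uniquely of the form $f^0\frac{\partial}{\partial t}+X$ with $f^0$ a function on $\mathbb{R}\times M$ and $X$ a time-dependent vector field. A dot denotes the time derivative at a fixed point of $M$: $\dot g^0=\partial g^0/\partial t$, and $\dot Y(t,p)$ is the derivative of $t\mapsto Y(t,p)\in \mathrm{T}_pM$. $\mathscr{L}_Xg^0$ is the Lie derivative with frozen time: $(\mathscr{L}_Xg^0)(t,\cdot)=\mathscr{L}_{X_t}(g^0(t,\cdot))$. A time-dependent connection on $M$ is a smooth one-parameter family ${}^t\nabla$ of connections on $M$, and for time-dependent $X,Y$, $(\nabla_XY)(t,\cdot)={}^t\nabla_{X_t}Y_t$. *)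

(* Defs.v *)
From mathcomp Require Import all_boot all_order all_algebra.
From mathcomp Require Import all_classical all_reals all_analysis.

Set Implicit Arguments.
Unset Strict Implicit.
Unset Printing Implicit Defensive.

Import Order.TTheory GRing.Theory Num.Theory.
Import numFieldNormedType.Exports.

Local Open Scope classical_set_scope.
Local Open Scope ring_scope.

Fixpoint Ck_on {R : realType} {V W : normedModType R}
    (k : nat) (U : set V) (f : V -> W) : Prop :=
  if k is k'.+1 then
    (forall x, U x -> differentiable f x) /\
    (forall v : V, Ck_on k' U (fun x => 'D_v f x : W))
  else {within U, continuous f}.

(* Only meant for open U: differentiability is the one at a point of the whole
   space V. *)
Definition Cinfty_on {R : realType} {V W : normedModType R}
    (U : set V) (f : V -> W) : Prop :=
  forall k, Ck_on k U f.

Definition paracompact (T : topologicalType) : Prop :=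
  forall C : set (set T),
    (forall U, C U -> open U) -> \bigcup_(U in C) U = setT ->
  exists D : set (set T),
    [/\ forall V, D V -> open V,
        forall V, D V -> exists2 U, C U & V `<=` U,
        \bigcup_(V in D) V = setT &
        forall x : T, exists2 N, nbhs x N &
          finite_set [set V | D V /\ V `&` N !=set0]].

(* [cphi] is meaningful on [cdom], and its inverse [cinv] on the image
   [cphi @` cdom]; elsewhere their values are irrelevant. *)
Record chart (R : realType) (n : nat) (T : topologicalType) := Chart {
  cdom : set T;
  cphi : T -> 'rV[R]_n;
  cinv : 'rV[R]_n -> T }.

Definition is_chart (R : realType) (n : nat) (T : topologicalType)
    (c : chart R n T) : Prop :=
  [/\ open (cdom c),
      open (cphi c @` cdom c),
      (forall p, cdom c p -> cinv c (cphi c p) = p),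
      {within cdom c, continuous (cphi c)} &
      {within cphi c @` cdom c, continuous (cinv c)}].

(* A space with an atlas, not necessarily maximal, and around each point a
   preferred chart of the atlas. The axioms are in [is_manifold]. *)
Record charted (R : realType) (n : nat) := Charted {
  cpoint :> topologicalType;
  atlas : set (chart R n cpoint);
  chart_at : cpoint -> chart R n cpoint }.
Arguments atlas {R n} c _.

Record is_manifold (R : realType) (n : nat) (M : charted R n) : Prop :=
  IsManifold {
  mfd_hausdorff : hausdorff_space M;
  mfd_paracompact : paracompact M;
  mfd_chart : forall c, atlas M c -> is_chart c;
  mfd_chart_at : forall p : M, atlas M (chart_at p);
  mfd_cover : forall p : M, cdom (chart_at p) p;
  mfd_transition : forall c c', atlas M c -> atlas M c' ->
    Cinfty_on (cphi c @` (cdom c `&` cdom c')) (cphi c' \o cinv c) }.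

Definition smooth_on (R : realType) (n : nat) (M : charted R n)
    (W : normedModType R) (U : set M) (f : M -> W) : Prop :=
  forall c, atlas M c -> Cinfty_on (cphi c @` (cdom c `&` U)) (f \o cinv c).

Definition smooth (R : realType) (n : nat) (M : charted R n)
    (f : M -> R) : Prop :=
  smooth_on setT f.

(* A tangent vector at p is represented by its components in the preferred
   chart at p. Components in the other charts around p, and hence smoothness
   of fields, are obtained with the Jacobian of the coordinate change, so that
   nothing depends on the choice of the preferred charts. *)
Definition tangent (R : realType) (n : nat) (M : charted R n) (p : M) :=
  'rV[R]_n.

Definition components (R : realType) (n : nat) (M : charted R n)
    (c : chart R n M) (p : M) (v : tangent p) : 'rV[R]_n :=
  'D_v (cphi c \o cinv (chart_at p)) (cphi (chart_at p) p).

Definition of_components (R : realType) (n : nat) (M : charted R n)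
    (c : chart R n M) (p : M) (w : 'rV[R]_n) : tangent p :=
  'D_w (cphi (chart_at p) \o cinv c) (cphi c p).

Definition smooth_field (R : realType) (n : nat) (M : charted R n)
    (X : forall p : M, tangent p) : Prop :=
  forall c, atlas M c -> smooth_on (cdom c) (fun p => components c (X p)).

Definition lie (R : realType) (n : nat) (M : charted R n)
    (X : forall p : M, tangent p) (f : M -> R) (p : M) : R :=
  'D_(X p) (f \o cinv (chart_at p)) (cphi (chart_at p) p).

(* Linear connections on the tangent bundle, as operators on smooth vector
   fields; the values on fields that are not smooth are irrelevant.
   Linearity over the constants in Y follows from [conn_leibniz]. *)
Record is_connection (R : realType) (n : nat) (M : charted R n)
    (nabla : (forall p : M, tangent p) -> (forall p : M, tangent p) ->
             forall p : M, tangent p) : Prop := IsConnection {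
  conn_smooth : forall X Y, smooth_field X -> smooth_field Y ->
    smooth_field (nabla X Y);
  conn_addl : forall X X' Y,
    smooth_field X -> smooth_field X' -> smooth_field Y ->
    forall p, nabla (fun q => X q + X' q) Y p = nabla X Y p + nabla X' Y p;
  conn_scalel : forall f X Y,
    smooth f -> smooth_field X -> smooth_field Y ->
    forall p, nabla (fun q => f q *: X q) Y p = f p *: nabla X Y p;
  conn_addr : forall X Y Y',
    smooth_field X -> smooth_field Y -> smooth_field Y' ->
    forall p, nabla X (fun q => Y q + Y' q) p = nabla X Y p + nabla X Y' p;
  conn_leibniz : forall f X Y,
    smooth f -> smooth_field X -> smooth_field Y ->
    forall p, nabla X (fun q => f q *: Y q) p =
              lie X f p *: Y p + f p *: nabla X Y p }.

Definition line_chart (R : realType) (n : nat) (T : topologicalType)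
    (c : chart R n T) : chart R (1 + n) (R * T)%type :=
  Chart [set q : R * T | cdom c q.2]
        (fun q => row_mx (q.1)%:M (cphi c q.2))
        (fun x => (lsubmx x 0 0, cinv c (rsubmx x))).

(* The product manifold of the real line and M. *)
Definition line_prod (R : realType) (n : nat) (M : charted R n) :
    charted R (1 + n) :=
  @Charted R (1 + n) (R * M)%type
    (@line_chart R n M @` atlas M) (fun q => line_chart (chart_at q.2)).

Definition ddt (R : realType) (n : nat) (M : charted R n)
    (q : line_prod M) : tangent q :=
  row_mx 1%:M 0.

(* Time-dependent objects on M are sections along the projection [snd] from
   [line_prod M] to M. *)

Definition td_smooth_field (R : realType) (n : nat) (M : charted R n)
    (X : forall q : line_prod M, tangent (q.2 : M)) : Prop :=
  forall c, atlas M c ->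
    smooth_on (M := line_prod M) [set q | cdom c q.2]
      (fun q => components c (X q)).

(* A time-dependent vector field on M as a vector field on [line_prod M]. *)
Definition td_lift (R : realType) (n : nat) (M : charted R n)
    (X : forall q : line_prod M, tangent (q.2 : M))
    (q : line_prod M) : tangent q :=
  row_mx 0 (X q).

Definition freeze (R : realType) (n : nat) (M : charted R n) (t : R)
    (X : forall q : line_prod M, tangent (q.2 : M)) (p : M) : tangent p :=
  X (t, p).

Definition td_form (R : realType) (n : nat) (M : charted R n)
    (alpha : forall q : line_prod M, tangent (q.2 : M) -> R) : Prop :=
  (forall q, scalar (alpha q)) /\
  (forall c, atlas M c -> forall w : 'rV[R]_n,
    smooth_on (M := line_prod M) [set q | cdom c q.2]
      (fun q => alpha q (of_components c q.2 w))).

Definition td_covariant2 (R : realType) (n : nat) (M : charted R n)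
    (eps : forall q : line_prod M,
             tangent (q.2 : M) -> tangent (q.2 : M) -> R) : Prop :=
  (forall q, bilinear_for *%R *%R (eps q)) /\
  (forall c, atlas M c -> forall w w' : 'rV[R]_n,
    smooth_on (M := line_prod M) [set q | cdom c q.2]
      (fun q => eps q (of_components c q.2 w) (of_components c q.2 w'))).

Definition td_endomorphism (R : realType) (n : nat) (M : charted R n)
    (A : forall q : line_prod M,
           tangent (q.2 : M) -> tangent (q.2 : M)) : Prop :=
  (forall q, linear (A q)) /\
  (forall c, atlas M c -> forall w : 'rV[R]_n,
    smooth_on (M := line_prod M) [set q | cdom c q.2]
      (fun q => components c (A q (of_components c q.2 w)))).

Definition td_nabla (R : realType) (n : nat) (M : charted R n)
    (nabla : R -> (forall p : M, tangent p) -> (forall p : M, tangent p) ->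
             forall p : M, tangent p)
    (X Y : forall q : line_prod M, tangent (q.2 : M))
    (q : line_prod M) : tangent (q.2 : M) :=
  nabla q.1 (freeze q.1 X) (freeze q.1 Y) q.2.

Definition td_connection (R : realType) (n : nat) (M : charted R n)
    (nabla : R -> (forall p : M, tangent p) -> (forall p : M, tangent p) ->
             forall p : M, tangent p) : Prop :=
  (forall t, is_connection (nabla t)) /\
  (forall X Y, td_smooth_field X -> td_smooth_field Y ->
    td_smooth_field (td_nabla nabla X Y)).

Definition dot_fun (R : realType) (n : nat) (M : charted R n)
    (g : line_prod M -> R) (q : line_prod M) : R :=
  derive1 (fun t : R => g (t, q.2)) q.1.

Definition dot_field (R : realType) (n : nat) (M : charted R n)
    (Y : forall q : line_prod M, tangent (q.2 : M))
    (q : line_prod M) : tangent (q.2 : M) :=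
  derive1 (fun t : R => Y (t, q.2) : 'rV[R]_n) q.1.

Definition td_lie (R : realType) (n : nat) (M : charted R n)
    (X : forall q : line_prod M, tangent (q.2 : M))
    (g : line_prod M -> R) (q : line_prod M) : R :=
  lie (freeze q.1 X) (fun p => g (q.1, p)) q.2.

(* Main.v *)
(* At a point q, [nablahat X Y q] depends on X only through X q, and, if Y
   vanishes at q, it is the derivative along X q of the components of Y.
   Decompose the fields into their d/dt-parts and their M-parts and expand
   [nablahat] by bilinearity and the Leibniz rule.
   The d/dt- and M-components of nablahat_dt dt, of nablahat_X dt and of
   nablahat_dt Y - dY/dt are then tensors lambda, C, alpha, A, beta, B, and the
   d/dt-component of nablahat_X Y is a tensor epsilon.  The M-component of
   nablahat_X Y at time t depends only on the restrictions of X and Y to the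
   slice {t} x M, because a field vanishing on the slice has zero derivative
   along it: it is the time-dependent connection.  The tensors are defined by
   evaluating [nablahat] on arbitrary time-independent extensions of tangent
   vectors. *)
Require Import Defs.
From mathcomp Require Import all_boot all_order all_algebra.
From mathcomp Require Import all_classical all_reals all_analysis.
From mathcomp Require Import ring lra.

Set Implicit Arguments.
Unset Strict Implicit.
Unset Printing Implicit Defensive.

Import Order.TTheory GRing.Theory Num.Theory.
Import numFieldNormedType.Exports.

Local Open Scope classical_set_scope.
Local Open Scope ring_scope.

(** * Functions of class C^k *)

(** A connection is given only as an operator on global fields, so nothing can be restricted to a
    chart directly: local computations use globally smooth fields cut off by bump functions, and
    this is where the Hausdorff property enters. The extension of a tangent vector to a field is a
    pointwise choice, neither linear in the vector nor smooth in its base point. Linearity and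
    smoothness of the tensors come instead from independence of the extension: at each q the chosen
    extension may be exchanged for a linear combination of others, or for one fixed field. In the
    second argument this exchange costs the derivative of the coordinates of the difference of the
    two fields. Coordinate changes of product charts leave t alone, so lifts have d/dt-component 0
    in every product chart and the cost has no d/dt-part. Along d/dt the cost is the time derivative
    of the difference, which is 0 between time-independent extensions. Along the slice it is 0 as
    soon as the two fields agree on the slice. *)

Section Calculus.
Context {R : realType}.

(** The little-o expansion of [f] at [x] only sees values near [x], so ['d f x] is also the
    differential of [g]. *)
Lemma near_eq_differentiable (V W : normedModType R) (f g : V -> W) (x : V) :
  (\near x, f x = g x) -> differentiable f x -> differentiable g x.
Proof.
move=> fg /diff_locallyP[cdf Hf].
have fgx : f x = g x by exact: (nbhs_singleton fg).
have fgs : \forall h \near 0, f (h + x) = g (h + x).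
  have sx : (h + x @[h --> (0 : V)]) --> x.
    rewrite -[X in _ --> X]add0r.
    by apply: cvgD; [exact: cvg_id|exact: cvg_cst].
  exact: (sx _ fg).
have Hg : g \o shift x = cst (g x) + 'd f x +o_ (0 : V) id.
  apply/eqaddoP => e e0; have /eqaddoP/(_ e e0) := Hf.
  apply: filterS2 fgs => h /= fgh.
  by rewrite !fctE /= -fgh fgx.
apply/diff_locallyP; rewrite (diff_unique cdf Hg); split => //.
Qed.

Lemma Ck0_openP (V W : normedModType R) (U : set V) (f : V -> W) : open U ->
  Ck_on 0 U f <-> (forall x, U x -> {for x, continuous f}).
Proof.
move=> oU /=; rewrite continuous_open_subspace//.
by split=> [H x Ux|H x /[!inE]]; [apply: H; rewrite inE|exact: H].
Qed.

Lemma Ck_on_ext k (V W : normedModType R) (U : set V) (f g : V -> W) : open U ->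
  (forall x, U x -> f x = g x) -> Ck_on k U f -> Ck_on k U g.
Proof.
move=> oU; elim: k f g => [|k IH] f g fg.
  move=> /(Ck0_openP _ oU) cf; apply/(Ck0_openP _ oU) => x Ux.
  have fgx : \near x, f x = g x.
    by apply: filterS (open_nbhs_nbhs (conj oU Ux)).
  rewrite /prop_for /continuous_at -(fg _ Ux).
  by apply: cvg_trans (cf _ Ux); exact: near_eq_cvg.
have nfg x : U x -> \near x, f x = g x.
  by move=> Ux; apply: filterS (open_nbhs_nbhs (conj oU Ux)).
move=> [df Df]; split=> [x Ux|v].
  by apply: near_eq_differentiable (nfg _ Ux) (df _ Ux).
by apply: IH (Df v) => x Ux; exact: near_eq_derive (nfg _ Ux).
Qed.

Lemma Ck_onW k (V W : normedModType R) (U : set V) (f : V -> W) : open U ->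
  Ck_on k.+1 U f -> Ck_on k U f.
Proof.
move=> oU; elim: k f => [|k IH] f.
  move=> [df _]; apply/(Ck0_openP _ oU) => x Ux.
  exact: differentiable_continuous (df _ Ux).
by move=> [df Df]; split=> // v; exact: IH (Df v).
Qed.

Lemma Ck_on_sub k (V W : normedModType R) (U U' : set V) (f : V -> W) :
  open U -> open U' -> U' `<=` U -> Ck_on k U f -> Ck_on k U' f.
Proof.
move=> oU oU' UU'; elim: k f => [|k IH] f.
  move=> /(Ck0_openP _ oU) cf; apply/(Ck0_openP _ oU') => x /UU' Ux.
  exact: cf.
by move=> [df Df]; split=> [x /UU' Ux|v]; [exact: df|exact: IH (Df v)].
Qed.

Lemma Ck_on_local k (V W : normedModType R) (U : set V) (f : V -> W) :
  open U ->
  (forall x, U x -> exists B, [/\ open B, B x & Ck_on k B f]) -> Ck_on k U f.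
Proof.
move=> oU; elim: k f => [|k IH] f H.
  apply/(Ck0_openP _ oU) => x /H[B [oB Bx]].
  by move=> /(Ck0_openP _ oB) cf; exact: cf.
split=> [x /H[B [oB Bx [df _]]]|v]; first exact: df.
by apply: IH => x /H[B [oB Bx [_ Df]]]; exists B; split=> //; exact: Df.
Qed.

Lemma Ck_on_cst k (V W : normedModType R) (U : set V) (a : W) : open U ->
  Ck_on k U (fun=> a : W).
Proof.
move=> oU; elim: k a => [|k IH] a.
  by apply/(Ck0_openP _ oU) => x _; exact: cvg_cst.
split=> [x _|v]; first exact: differentiable_cst.
by apply: (Ck_on_ext oU _ (IH 0)) => x _; rewrite derive_cst.
Qed.

Lemma Ck_onD k (V W : normedModType R) (U : set V) (f g : V -> W) : open U ->
  Ck_on k U f -> Ck_on k U g -> Ck_on k U (fun x => f x + g x).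
Proof.
move=> oU; elim: k f g => [|k IH] f g.
  move=> /(Ck0_openP _ oU) cf /(Ck0_openP _ oU) cg.
  apply/(Ck0_openP _ oU) => x Ux; apply: cvgD; [exact: cf|exact: cg].
move=> [df Df] [dg Dg]; split=> [x Ux|v].
  by apply: differentiableD; [exact: df|exact: dg].
apply: (Ck_on_ext oU _ (IH _ _ (Df v) (Dg v))) => x Ux.
by rewrite deriveD//; apply: diff_derivable; [exact: df|exact: dg].
Qed.

Lemma Ck_onM k (V : normedModType R) (U : set V) (f g : V -> R) : open U ->
  Ck_on k U f -> Ck_on k U g -> Ck_on k U (fun x => f x * g x).
Proof.
move=> oU; elim: k f g => [|k IH] f g.
  move=> /(Ck0_openP _ oU) cf /(Ck0_openP _ oU) cg.
  apply/(Ck0_openP _ oU) => x Ux; apply: cvgM; [exact: cf|exact: cg].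
move=> Cf Cg; have [df Df] := Cf; have [dg Dg] := Cg; split=> [x Ux|v].
  by apply: differentiableM; [exact: df|exact: dg].
have H := Ck_onD oU (IH _ _ (Ck_onW oU Cf) (Dg v))
  (IH _ _ (Ck_onW oU Cg) (Df v)).
apply: (Ck_on_ext oU _ H) => x Ux.
by rewrite deriveM//; apply: diff_derivable; [exact: df|exact: dg].
Qed.

Lemma Ck_on_sum k (V W : normedModType R) (U : set V) m (f : 'I_m -> V -> W) :
  open U -> (forall i, Ck_on k U (f i)) -> Ck_on k U (fun x => \sum_i f i x).
Proof.
move=> oU H; elim: (index_enum _) => [|i s IH].
  by apply: (Ck_on_ext oU _ (Ck_on_cst k _ oU)) => x _; rewrite big_nil.
apply: (Ck_on_ext oU _ (Ck_onD oU (H i) IH)) => x _; rewrite big_cons//.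
Qed.

Lemma continuous_rowP (T : topologicalType) m (f : T -> 'rV[R]_m) (x : T) :
  (forall i, {for x, continuous (fun y => f y 0 i)}) -> {for x, continuous f}.
Proof.
move=> H A [P fP sPA].
have : \forall y \near x, forall i, P 0 i (f y 0 i).
  by apply: filter_forall => i; exact: (H i _ (fP 0 i)).
by apply: filterS => y Py; apply: sPA => i j; rewrite ord1.
Qed.

Lemma differentiable_rowP (V : normedModType R) m (f : V -> 'rV[R]_m) (x : V) :
  differentiable f x <-> (forall i, differentiable (fun y => f y 0 i) x).
Proof.
split=> [df i|H].
  exact: (differentiable_comp df (differentiable_coord _ _ _)).
have -> : f = \sum_i (fun y => f y 0 i *: (delta_mx 0 i : 'rV[R]_m)).
  by apply/funext => y; rewrite fct_sumE -row_sum_delta.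
by apply: differentiable_sum => i; exact: differentiableZl.
Qed.

Lemma derive_row (V : normedModType R) m (f : V -> 'rV[R]_m) (x v : V) i :
  differentiable f x -> 'D_v f x 0 i = 'D_v (fun y => f y 0 i) x.
Proof. by move=> df; rewrite derive_mx ?mxE//; exact: diff_derivable. Qed.

Lemma Ck_on_rowP k (V : normedModType R) (U : set V) m (f : V -> 'rV[R]_m) :
  open U -> Ck_on k U f <-> (forall i, Ck_on k U (fun x => f x 0 i)).
Proof.
move=> oU; elim: k f => [|k IH] f.
  split=> [/(Ck0_openP _ oU) cf i|cf]; apply/(Ck0_openP _ oU) => x Ux.
    have cx : {for f x, continuous (fun M : 'rV[R]_m => M 0 i)}.
      exact: coord_continuous.
    exact: (continuous_comp (cf _ Ux) cx).
  by apply: continuous_rowP => i; have /(Ck0_openP _ oU) := cf i; exact.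
split=> [[df Df] i|H].
  split=> [x Ux|v]; first by have /differentiable_rowP := df x Ux; exact.
  have /IH/(_ i) := Df v; apply: Ck_on_ext => // x Ux.
  by rewrite derive_row//; exact: df.
have df x : U x -> differentiable f x.
  by move=> Ux; apply/differentiable_rowP => i; have [+ _] := H i; exact.
split=> // v; apply/IH => i; have [_ /(_ v)] := H i.
by apply: Ck_on_ext => // x Ux; rewrite derive_row//; exact: df.
Qed.

Lemma derive_comp (U V W : normedModType R) (f : U -> V)
    (g : V -> W) (x v : U) :
  differentiable f x -> differentiable g (f x) ->
  'D_v (g \o f) x = 'D_('D_v f x) g (f x).
Proof.
move=> df dg; rewrite [LHS]deriveE; last exact: differentiable_comp.
by rewrite diff_comp//= !deriveE.
Qed.

(** In the chain rule the direction ['D_v f x] moves with [x], whereas [Ck_on] controls derivatives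
    in fixed directions; expanding over the basis restores fixed directions. *)
Lemma derive_comp_row m (V W : normedModType R) (f : V -> 'rV[R]_m)
    (g : 'rV[R]_m -> W) (x v : V) :
  differentiable f x -> differentiable g (f x) ->
  'D_v (g \o f) x = \sum_i 'D_v f x 0 i *: 'D_(delta_mx 0 i) g (f x).
Proof.
move=> df dg; rewrite derive_comp// deriveE// [X in 'd g _ X]row_sum_delta.
rewrite linear_sum; apply: eq_bigr => i _.
by rewrite linearZ -!deriveE.
Qed.

(** Induction on [k] with [f] fixed and [g] varying: the derivative is a sum of products of
    components of ['D_v f] with partial derivatives of [g] composed with [f]. Scalar values of [g]
    make these products accessible to [Ck_onM]. *)
Lemma Ck_on_compR k m (V : normedModType R) (U : set V) (U' : set 'rV[R]_m)
    (f : V -> 'rV[R]_m) (g : 'rV[R]_m -> R) :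
  open U -> open U' -> (forall x, U x -> U' (f x)) ->
  Ck_on k U f -> Ck_on k U' g -> Ck_on k U (g \o f).
Proof.
move=> oU oU' UU'; elim: k g => [|k IH] g.
  move=> /(Ck0_openP _ oU) cf /(Ck0_openP _ oU') cg.
  apply/(Ck0_openP _ oU) => x Ux.
  exact: continuous_comp (cf _ Ux) (cg _ (UU' _ Ux)).
move=> Cf [dg Dg]; have [df Df] := Cf.
have Cf' := Ck_onW oU Cf.
split=> [x Ux|v].
  by apply: differentiable_comp; [exact: df|exact: dg (UU' _ Ux)].
have H : Ck_on k U (fun x => \sum_i 'D_v f x 0 i * 'D_(delta_mx 0 i) g (f x)).
  apply: Ck_on_sum => // i; apply: Ck_onM => //.
    by have /(Ck_on_rowP _ _ oU) := Df v; exact.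
  exact: (IH _ Cf' (Dg _)).
apply: (Ck_on_ext oU _ H) => x Ux.
by rewrite derive_comp_row//; [exact: df|exact: dg (UU' _ Ux)].
Qed.

Lemma Ck_on_comp k m p (V : normedModType R) (U : set V) (U' : set 'rV[R]_m)
    (f : V -> 'rV[R]_m) (g : 'rV[R]_m -> 'rV[R]_p) :
  open U -> open U' -> (forall x, U x -> U' (f x)) ->
  Ck_on k U f -> Ck_on k U' g -> Ck_on k U (g \o f).
Proof.
move=> oU oU' UU' Cf /(Ck_on_rowP _ _ oU') Cg; apply/(Ck_on_rowP _ _ oU) => i.
exact: (Ck_on_compR oU oU' UU' Cf (Cg i)).
Qed.

(** [G] lists a function together with its successive derivatives. Differentiating [G j \o s]
    produces [G j.+1 \o s], so the induction on [k] treats all [j] at once. *)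
Lemma Ck_on_chain k (V : normedModType R) (U : set V) (s : V -> R)
    (G : nat -> R -> R) :
  open U -> (forall j (x : R), is_derive x (1 : R) (G j) (G j.+1 x)) ->
  Ck_on k U s -> forall j, Ck_on k U (G j \o s).
Proof.
move=> oU dG; have dG' j x : differentiable (G j) x.
  by apply/derivable1_diffP; exact: ex_derive.
elim: k => [|k IH].
  move=> /(Ck0_openP _ oU) cs j; apply/(Ck0_openP _ oU) => x Ux.
  exact: continuous_comp (cs _ Ux) (differentiable_continuous (dG' j _)).
move=> Cs j; have [ds Ds] := Cs; split=> [x Ux|v].
  exact: (differentiable_comp (ds _ Ux) (dG' j _)).
have H := Ck_onM oU (Ds v) (IH (Ck_onW oU Cs) j.+1).
apply: (Ck_on_ext oU _ H) => x Ux /=.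
rewrite -[RHS]/('D_v (G j \o s) x) (derive_comp v (ds _ Ux) (dG' j _)).
by rewrite [in RHS]deriveE// diff1E// derive1E derive_val.
Qed.

Lemma Ck_on_lin k (V W : normedModType R) (U : set V) (f : {linear V -> W}) :
  open U -> continuous f -> Ck_on k U f.
Proof.
move=> oU cf; case: k => [|k].
  by apply/(Ck0_openP _ oU) => x _; exact: cf.
split=> [x _|v]; first exact: linear_differentiable.
apply: (Ck_on_ext oU _ (Ck_on_cst k (f v) oU)) => x _.
by rewrite deriveE ?diff_lin//; exact: linear_differentiable.
Qed.

End Calculus.

(** * A smooth step *)

Section SmoothStep.
Context {R : realType}.

(* The derivatives of [expR (- x^-1)], extended by 0 to [x <= 0], all have this
   form. *)
Definition flat (p : {poly R}) (x : R) : R :=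
  if 0 < x then p.[x^-1] * expR (- x^-1) else 0.

(** With y = 1/x, this is the domination of polynomials in y by exp y. In the Horner step the extra
    factor y costs one power of x, hence the induction hypothesis at [m.+1]; the constant term uses
    y^m <= m! exp y. *)
Lemma flat_bound (p : {poly R}) (m : nat) :
  exists C : R, forall x, 0 < x -> `|p.[x^-1]| * expR (- x^-1) <= C * x ^+ m.
Proof.
elim/poly_ind: p m => [|p c IH] m.
  by exists 0 => x x0; rewrite horner0 normr0 !mul0r.
have [C HC] := IH m.+1; exists (C + `|c| * m`!%:R) => x x0.
have y0 : 0 < x^-1 by rewrite invr_gt0.
have Hm : expR (- x^-1) <= m`!%:R * x ^+ m.
  have Hy : x^-1 ^+ m <= m`!%:R * expR x^-1.
    case: m {HC} => [|m]; first by rewrite expr0 mul1r -expR0 ler_expR ltW.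
    rewrite mulrC -ler_pdivrMr ?ltr0n ?fact_gt0//.
    by apply: le_trans (expR_ge1Dxn m (ltW y0)); rewrite lerDr.
  rewrite expRN -[leLHS]mul1r ler_pdivrMr ?expR_gt0// mulrAC.
  by rewrite -[x ^+ m]invrK -exprVn ler_pdivlMr ?exprn_gt0// mul1r.
rewrite hornerMXaddC [leRHS]mulrDl.
apply: (@le_trans _ _ ((`|p.[x^-1] * x^-1| + `|c|) * expR (- x^-1))).
  by rewrite ler_wpM2r ?expR_ge0// ler_normD.
rewrite mulrDl lerD//; last by rewrite -mulrA ler_wpM2l.
rewrite normrM (gtr0_norm y0) mulrAC ler_pdivrMr// -mulrA -exprSr.
exact: HC.
Qed.

(** For x > 0, differentiating p(1/x) exp(-1/x) brings out 1/x^2, once with p (from the exponential)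
    and once with -p' (from the polynomial). Flatness at 0 comes from [flat_bound]. *)
Lemma is_derive_flat (p : {poly R}) (x : R) :
  is_derive x (1 : R) (flat p) (flat ('X^2 * (p - p^`())) x).
Proof.
have [x0|x0|->] := ltgtP x 0.
- rewrite {2}/flat ltNge (ltW x0)/=.
  apply: (near_eq_is_derive (f := cst 0)).
  near=> y; rewrite /flat ltNge (_ : y <= 0)//.
  by near: y; exact: lt_le_nbhsl.
- rewrite {2}/flat x0.
  apply: (near_eq_is_derive (f := fun y : R => p.[y^-1] * expR (- y^-1) : R)).
    by near=> y; rewrite /flat ifT//; near: y; exact: lt_nbhsr.
  have xN0 : x != 0 by rewrite gt_eqF.
  have dV : is_derive x (1 : R) (fun y => y^-1) (- x ^- 2).
    apply: DeriveDef; first exact: (derivableV (f := id)).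
    by rewrite (deriveV (f := id))// derive_id [_ *: _]mulr1.
  have dp := is_derive1_comp (is_derive_poly p x^-1) dV.
  have de := @is_derive1_comp R expR (fun y => - y^-1) x _ _
    (is_derive_expR _) (is_deriveN dV).
  apply: (is_derive_eq (is_deriveM dp de)) => /=.
  rewrite hornerM hornerXn hornerD hornerN opprK exprVn.
  by rewrite ![_ *: _]mulrC; ring.
- rewrite {2}/flat ltxx.
  (* A quadratic bound suffices: the difference quotient at 0 is then O(h). *)
  have [C HC] := flat_bound p 2.
  have fl h : `|flat p h| <= `|C| * h ^+ 2.
    rewrite /flat; case: ifPn => h0; last first.
      by rewrite normr0 mulr_ge0// sqr_ge0.
    rewrite normrM (ger0_norm (expR_ge0 _)) (le_trans (HC _ h0))//.
    by rewrite ler_wpM2r ?sqr_ge0// ler_norm.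
  have f0 : flat p 0 = 0 by rewrite /flat ltxx.
  have H : h^-1 *: (flat p (h *: (1 : R) + 0) - flat p 0) @[h --> 0^']
      --> (0 : R).
    apply/cvgrPdist_le => e e0; near=> h.
    rewrite sub0r normrN addr0 f0 subr0 [h *: _]mulr1 normrZ normfV.
    have h0 : h != 0 by near: h; exact: nbhs_dnbhs_neq.
    have hp : 0 < `|h| by rewrite normr_gt0.
    rewrite mulrC ler_pdivrMr// (le_trans (fl h))//.
    rewrite -real_normK ?num_real// expr2 mulrA ler_wpM2r//.
    rewrite (@le_trans _ _ ((`|C| + 1) * `|h|))//.
      by rewrite ler_wpM2r// lerDl.
    rewrite -ler_pdivlMl ?ltr_wpDl//.
    near: h; apply: dnbhs0_le; rewrite mulr_gt0// invr_gt0 ltr_wpDl//.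
  apply: DeriveDef; first by apply/cvg_ex; exists 0.
  exact: (cvg_lim _ H).
Unshelve. all: by end_near. Qed.

(** Smoothness is phrased as stability of [Ck_on] under composition, since [g] is applied to a
    function of chart coordinates. *)
Lemma smooth_step : exists g : R -> R,
  [/\ forall k (V : normedModType R) (U : set V) (s : V -> R), open U ->
        Ck_on k U s -> Ck_on k U (g \o s),
      forall x, x <= 0 -> g x = 1 & forall x, 1 <= x -> g x = 0].
Proof.
pose e := flat 1.
have e_smooth k (V : normedModType R) (U : set V) (s : V -> R) :
    open U -> Ck_on k U s -> Ck_on k U (e \o s).
  move=> oU Cs.
  (* [D] is differentiation read on the polynomials, so [flat (iter j D 1)] is the j-th derivative
     of [e]. *)
  pose D (p : {poly R}) := 'X^2 * (p - p^`()).
  exact: (Ck_on_chain oU (G := fun j => flat (iter j D 1))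
    (fun j x => is_derive_flat _ x) Cs 0%N).
have eE x : 0 < x -> e x = expR (- x^-1).
  by move=> x0; rewrite /e /flat x0 hornerC mul1r.
have e0 x : x <= 0 -> e x = 0 by move=> x0; rewrite /e /flat ltNge x0.
have e1 : 0 < e 1 by rewrite eE// expR_gt0.
have ee1 : e (e 1) != 0 by rewrite eE// gt_eqF// expR_gt0.
(* As [e] vanishes exactly on the nonpositive reals and increases afterwards, the inner argument is
   [e 1] for x <= 0 and is nonpositive for x >= 1; the division normalizes the first value to 1. *)
exists (fun x => e (e 1 - e x) / e (e 1)); split.
- move=> k V U s oU Cs.
  have Ca := Ck_on_cst k (e 1) oU.
  have Cb := Ck_on_cst k (-1 : R) oU.
  have Cc := Ck_on_cst k ((e (e 1))^-1) oU.
  have H := Ck_onM oU (e_smooth k _ _ _ oU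
    (Ck_onD oU Ca (Ck_onM oU Cb (e_smooth k _ _ _ oU Cs)))) Cc.
  by apply: (Ck_on_ext oU _ H) => x _ /=; rewrite mulN1r.
- by move=> x x0; rewrite (e0 x)// subr0 divff.
- move=> x x1; rewrite (e0 (_ - _)) ?mul0r// subr_le0 !eE ?ltr01//.
    by rewrite ler_expR lerN2 invr1 invf_le1// (lt_le_trans _ x1).
  by rewrite (lt_le_trans _ x1).
Qed.

End SmoothStep.

(** * Charts, smooth functions and bump functions *)

(* [is_manifold] without paracompactness, which plays no role in local
   computations. *)
Record is_premanifold (R : realType) (n : nat) (N : charted R n) : Prop :=
  IsPremanifold {
  pre_hausdorff : hausdorff_space N;
  pre_chart : forall c, atlas N c -> is_chart c;
  pre_chart_at : forall p : N, atlas N (chart_at p);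
  pre_cover : forall p : N, cdom (chart_at p) p;
  pre_transition : forall c c', atlas N c -> atlas N c' ->
    Cinfty_on (cphi c @` (cdom c `&` cdom c')) (cphi c' \o cinv c) }.

Lemma manifold_premanifold (R : realType) (n : nat) (M : charted R n) :
  is_manifold M -> is_premanifold M.
Proof. by case=> ? _ ? ? ? ?; split. Qed.

Section Charts.
Context {R : realType} {n : nat} {T : topologicalType} (c : chart R n T).
Hypothesis Hc : is_chart c.

Lemma open_cdom : open (cdom c). Proof. by case: Hc. Qed.

Lemma cphiK p : cdom c p -> cinv c (cphi c p) = p.
Proof. by case: Hc => _ _ + _ _; exact. Qed.

Lemma cphi_continuous p : cdom c p -> {for p, continuous (cphi c)}.
Proof.
case: Hc => oc _ _ + _ cp; rewrite continuous_open_subspace//.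
by apply; rewrite inE.
Qed.

Lemma cinv_continuous x : (cphi c @` cdom c) x -> {for x, continuous (cinv c)}.
Proof.
case: Hc => _ oc _ _ + cx; rewrite continuous_open_subspace//.
by apply; rewrite inE.
Qed.

(** Within the chart image, the image of [U] is the preimage of [U] under the continuous
    [cinv c]. *)
Lemma open_cphi (U : set T) : open U -> open (cphi c @` (cdom c `&` U)).
Proof.
case: Hc => _ oc cK _ ci oU.
rewrite (_ : _ @` _ = (cphi c @` cdom c) `&` cinv c @^-1` U).
  have [+ _] := continuous_inP (cinv c) oc; apply=> //.
  by rewrite -continuous_open_subspace.
apply/seteqP; split=> [_ [p [cp Up] <-]|_ [[p cp <-]]].
  by split; [exists p|rewrite /= cK].
by rewrite /= cK// => Up; exists p.
Qed.

Lemma near_cphi (P : T -> Prop) p : cdom c p ->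
  (\forall q \near p, P q) -> \forall x \near cphi c p, P (cinv c x).
Proof.
move=> cp nP; have H := @cinv_continuous (cphi c p) (ex_intro2 _ _ _ cp erefl).
by apply: H; rewrite cphiK.
Qed.

End Charts.

Section SmoothOn.
Context {R : realType} {n : nat} (N : charted R n).
Hypothesis HN : is_premanifold N.
Let chartN c := @pre_chart _ _ _ HN c.

Lemma smooth_on_ext (W : normedModType R) (U : set N) (f g : N -> W) :
  open U -> (forall p, U p -> f p = g p) -> smooth_on U f -> smooth_on U g.
Proof.
move=> oU fg sf c Ac k; have cc := chartN Ac.
apply: (Ck_on_ext (open_cphi cc oU) _ (sf c Ac k)) => _ [p [cp Up] <-] /=.
by rewrite cphiK// fg.
Qed.

Lemma smooth_on_sub (W : normedModType R) (U U' : set N) (f : N -> W) :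
  open U -> open U' -> U' `<=` U -> smooth_on U f -> smooth_on U' f.
Proof.
move=> oU oU' UU' sf c Ac k; have cc := chartN Ac.
apply: (Ck_on_sub (open_cphi cc oU) (open_cphi cc oU') _ (sf c Ac k)).
by move=> _ [p [cp Up] <-]; exists p => //; split=> //; exact: UU'.
Qed.

Lemma smooth_on_local (W : normedModType R) (U : set N) (f : N -> W) :
  open U -> (forall p, U p -> exists B, [/\ open B, B p & smooth_on B f]) ->
  smooth_on U f.
Proof.
move=> oU H c Ac k; have cc := chartN Ac.
apply: Ck_on_local => [|_ [p [cp Up] <-]]; first exact: open_cphi.
have [B [oB Bp sf]] := H p Up.
exists (cphi c @` (cdom c `&` B)); split; [exact: open_cphi|by exists p|].
exact: sf.
Qed.

Lemma smooth_on_cst (W : normedModType R) (U : set N) (a : W) :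
  open U -> smooth_on U (fun=> a).
Proof. by move=> oU c /chartN cc k; apply: Ck_on_cst; exact: open_cphi. Qed.

Lemma smooth_onD (W : normedModType R) (U : set N) (f g : N -> W) : open U ->
  smooth_on U f -> smooth_on U g -> smooth_on U (fun p => f p + g p).
Proof.
move=> oU sf sg c Ac k; apply: (Ck_onD _ (sf c Ac k) (sg c Ac k)).
exact: (open_cphi (chartN Ac)).
Qed.

Lemma smooth_onM (U : set N) (f g : N -> R) : open U ->
  smooth_on U f -> smooth_on U g -> smooth_on U (fun p => f p * g p).
Proof.
move=> oU sf sg c Ac k; apply: (Ck_onM _ (sf c Ac k) (sg c Ac k)).
exact: (open_cphi (chartN Ac)).
Qed.

Lemma smooth_on_rowP m (U : set N) (f : N -> 'rV[R]_m) : open U ->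
  smooth_on U f <-> (forall i, smooth_on U (fun p => f p 0 i)).
Proof.
move=> oU; split=> [sf i c Ac k|sf c Ac k];
  have oc := open_cphi (chartN Ac) oU.
  by have /(Ck_on_rowP _ _ oc)/(_ i) := sf c Ac k.
by apply/(Ck_on_rowP _ _ oc) => i; exact: (sf i c Ac k).
Qed.

Lemma smooth_onZ m (U : set N) (f : N -> R) (g : N -> 'rV[R]_m) : open U ->
  smooth_on U f -> smooth_on U g -> smooth_on U (fun p => f p *: g p).
Proof.
move=> oU sf /(smooth_on_rowP _ oU) sg; apply/(smooth_on_rowP _ oU) => i.
apply: (smooth_on_ext oU _ (smooth_onM oU sf (sg i))) => p _.
by rewrite mxE.
Qed.

(** Reading the function in the single chart [c] suffices: in any other chart it is [g] after a
    transition map. *)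
Lemma smooth_on_chartR c (U : set N) (g : 'rV[R]_n -> R) : atlas N c ->
  open U -> U `<=` cdom c -> Cinfty_on (cphi c @` U) g ->
  smooth_on U (g \o cphi c).
Proof.
move=> Ac oU Uc sg c' Ac' k.
have oUc : open (cphi c @` U).
  by have := open_cphi (chartN Ac) oU; rewrite setIidr.
have oUc' := open_cphi (chartN Ac') oU.
have tr : Ck_on k (cphi c' @` (cdom c' `&` U)) (cphi c \o cinv c').
  apply: Ck_on_sub (pre_transition HN Ac' Ac k) => //.
    exact: (open_cphi (chartN Ac') (open_cdom (chartN Ac))).
  by move=> _ [p [cp Up] <-]; exists p => //; split=> //; exact: Uc.
apply: (Ck_on_compR oUc' oUc _ tr (sg k)) => _ [p [cp Up] <-] /=.
by rewrite (cphiK (chartN Ac') cp); exists p.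
Qed.

Lemma smooth_on_chart m c (U : set N) (g : 'rV[R]_n -> 'rV[R]_m) : atlas N c ->
  open U -> U `<=` cdom c -> Cinfty_on (cphi c @` U) g ->
  smooth_on U (g \o cphi c).
Proof.
move=> Ac oU Uc sg; apply/smooth_on_rowP => // i.
apply: (smooth_on_chartR Ac oU Uc (g := fun x => g x 0 i)) => k.
have oUc : open (cphi c @` U).
  by have := open_cphi (chartN Ac) oU; rewrite setIidr.
by have /(Ck_on_rowP _ _ oUc) := sg k; exact.
Qed.

(** [K] is the image of a compact coordinate box, hence compact, and closed because [N] is
    Hausdorff. Its open complement and the chart domain cover [N], and [phi] is smooth on each, so
    the extension by 0 is smooth. *)
Lemma bump c p0 : atlas N c -> cdom c p0 -> exists (phi : N -> R) (K : set N),
  [/\ smooth phi, \forall p \near p0, phi p = 1, closed K, K `<=` cdom c &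
      forall p, ~ K p -> phi p = 0].
Proof.
move=> Ac cp0; have cc := chartN Ac; set x0 := cphi c p0.
have [_ oc _ _ cic] := cc.
have /nbhs_ballP[r /= r0 ballr] : nbhs x0 (cphi c @` cdom c).
  by apply: open_nbhs_nbhs; split=> //; exists p0.
pose box := [set x : 'rV[R]_n | forall i,
  `[x0 0 i - r / 2, x0 0 i + r / 2]%classic (x 0 i)].
have boxc : box `<=` cphi c @` cdom c.
  move=> x bx; apply: ballr; split=> // i j; rewrite ord1.
  have := bx j; rewrite /= in_itv/= => /andP[xa xb].
  rewrite /ball/= ltr_norml.
  by apply/andP; split; lra.
have cbox : compact box.
  apply: (@rV_compact _ _ (fun i => `[x0 0 i - r / 2, x0 0 i + r / 2]%classic)).
  by move=> i; exact: segment_compact.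
pose K := cinv c @` box.
have cK : closed K.
  apply: compact_closed; first exact: pre_hausdorff HN.
  apply: continuous_compact => //; exact: continuous_subspaceW cic.
have Kc : K `<=` cdom c.
  by move=> _ [x /boxc[p cp <-] <-]; rewrite cphiK.
have [g [sg g1 g0]] := @smooth_step R.
(* Outside the box some coordinate is more than r/2 away from that of [x0], so the sum of squares
   exceeds r^2/4 = 2a and [s] is at least 1. At [x0] the value of [s] is -1, so [s] is negative
   nearby. *)
pose a := r ^+ 2 / 8.
have a0 : 0 < a by rewrite divr_gt0// exprn_gt0.
pose s (x : 'rV[R]_n) :=
  (\sum_i (x 0 i - x0 0 i) * (x 0 i - x0 0 i) - a) * a^-1.
have ss k : Ck_on k setT s.
  have oT : open [set: 'rV[R]_n] := openT.
  apply: Ck_onM => //; last exact: Ck_on_cst.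
  apply: Ck_onD => //; last exact: Ck_on_cst.
  have ci i : Ck_on k setT (fun x : 'rV[R]_n => x 0 i - x0 0 i).
    apply: Ck_onD => //; last exact: Ck_on_cst.
    have /(Ck_on_rowP _ _ oT) : Ck_on k setT (@idfun 'rV[R]_n).
      by apply: Ck_on_lin => // x; exact: cvg_id.
    by apply.
  by apply: Ck_on_sum => // i; exact: Ck_onM.
pose phi p := if `[< cdom c p >] then g (s (cphi c p)) else 0.
have phi0 p : ~ K p -> phi p = 0.
  move=> Kp; rewrite /phi; case: asboolP => // cp; apply: g0.
  have /existsNP[i Hi] : ~ box (cphi c p).
    by move=> bp; apply: Kp; exists (cphi c p) => //; rewrite cphiK.
  rewrite /s ler_pdivlMr// mul1r lerBrDr.
  rewrite (bigD1 i)//= ler_wpDr//.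
    by apply: sumr_ge0 => j _; rewrite -expr2 sqr_ge0.
  move/negP: Hi; rewrite in_itv/= negb_and -!ltNge /a => /orP[] Hi; nra.
exists phi, K; split => //.
- apply: smooth_on_local => [|p _]; first exact: openT.
  have [cp|cp] := pselect (cdom c p).
    exists (cdom c); split => //; first exact: open_cdom cc.
    have ocd := open_cdom cc.
    apply: (smooth_on_ext ocd (f := (g \o s) \o cphi c)).
      by move=> q cq; rewrite /phi asboolT.
    apply: (smooth_on_chartR Ac) => // k; apply: (Ck_on_sub openT oc) => //.
    exact: sg openT (ss k).
  exists (~` K); split; first exact: closed_openC.
    by move=> /Kc.
  apply: (smooth_on_ext (closed_openC cK) (f := fun=> 0)).
    by move=> q /phi0 ->.
  exact/smooth_on_cst/closed_openC.
- near=> p; have cp : cdom c p.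
    by near: p; apply: open_nbhs_nbhs; split=> //; exact: open_cdom cc.
  rewrite /phi asboolT//; apply: g1; rewrite ltW//.
  near: p.
  have s0 : s x0 < 0.
    rewrite /s big1 ?sub0r => [|i _]; last by rewrite subrr mul0r.
    by rewrite mulNr divff ?oppr_lt0// gt_eqF.
  have cs : {for x0, continuous s}.
    by have /(Ck0_openP _ openT) := ss 0%N; exact.
  have H := continuous_comp (cphi_continuous cc cp0) cs.
  by apply: (H [set y | y < 0]); exact: lt_nbhsl.
Unshelve. all: by end_near. Qed.

End SmoothOn.

(** * Tangent vectors and vector fields *)

Section TangentVectors.
Context {R : realType} {n : nat} (N : charted R n).
Hypothesis HN : is_premanifold N.
Let chartN c := @pre_chart _ _ _ HN c.

Lemma transition_differentiable c c' (p : N) : atlas N c -> atlas N c' ->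
  cdom c p -> cdom c' p -> differentiable (cphi c' \o cinv c) (cphi c p).
Proof.
move=> Ac Ac' cp cp'; have [H _] := pre_transition HN Ac Ac' 1%N.
by apply: H; exists p.
Qed.

(** The cocycle rule for Jacobians of coordinate changes: [cinv c'] followed by [cphi c'] after it
    cancel only near the point, which is enough for a derivative. *)
Lemma derive_transition_comp c c' c'' (p : N) w :
  atlas N c -> atlas N c' -> atlas N c'' ->
  cdom c p -> cdom c' p -> cdom c'' p ->
  'D_('D_w (cphi c' \o cinv c) (cphi c p)) (cphi c'' \o cinv c') (cphi c' p) =
  'D_w (cphi c'' \o cinv c) (cphi c p).
Proof.
move=> A0 A1 A2 p0 p1 p2.
have c'p : (cphi c' \o cinv c) (cphi c p) = cphi c' p.
  by rewrite /= (cphiK (chartN A0)).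
rewrite -c'p -derive_comp; last first.
- by rewrite c'p; exact: transition_differentiable.
- exact: transition_differentiable.
apply: near_eq_derive.
have : \forall q \near p, cdom c' q.
  by apply: open_nbhs_nbhs; split=> //; exact: open_cdom (chartN A1).
move=> /(near_cphi (chartN A0) p0); apply: filterS => x c'x /=.
by rewrite (cphiK (chartN A1)).
Qed.

Lemma derive_transition_id c (p : N) w : atlas N c -> cdom c p ->
  'D_w (cphi c \o cinv c) (cphi c p) = w.
Proof.
move=> Ac cp; rewrite -[RHS](derive_id (cphi c p)); apply: near_eq_derive.
have [_ oc _ _ _] := chartN Ac.
have : nbhs (cphi c p) (cphi c @` cdom c).
  by apply: open_nbhs_nbhs; split=> //; exists p.
by apply: filterS => _ [q cq <-] /=; rewrite (cphiK (chartN Ac)).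
Qed.

Lemma components_of c c' (p : N) w :
  atlas N c -> atlas N c' -> cdom c p -> cdom c' p ->
  components c' (of_components c p w) = 'D_w (cphi c' \o cinv c) (cphi c p).
Proof.
move=> Ac Ac' cp cp'; rewrite /components /of_components.
by apply: derive_transition_comp => //;
  [exact: pre_chart_at HN _|exact: pre_cover HN _].
Qed.

Lemma componentsK c (p : N) (v : tangent p) : atlas N c -> cdom c p ->
  of_components c p (components c v) = v.
Proof.
move=> Ac cp; rewrite /components /of_components derive_transition_comp//;
  do ?[exact: pre_chart_at HN _|exact: pre_cover HN _].
by apply: derive_transition_id;
  [exact: pre_chart_at HN _|exact: pre_cover HN _].
Qed.

Lemma components_chart_at (p : N) (v : tangent p) :
  components (chart_at p) v = v.
Proof.
by apply: derive_transition_id;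
  [exact: pre_chart_at HN _|exact: pre_cover HN _].
Qed.

Lemma of_components_chart_at (p : N) w : of_components (chart_at p) p w = w.
Proof.
by apply: derive_transition_id;
  [exact: pre_chart_at HN _|exact: pre_cover HN _].
Qed.

Lemma components_linear c (p : N) : atlas N c -> cdom c p ->
  linear (fun v : tangent p => components c v).
Proof.
move=> Ac cp a u v; rewrite /components.
have d : differentiable (cphi c \o cinv (chart_at p)) (cphi (chart_at p) p).
  by apply: transition_differentiable => //;
    [exact: pre_chart_at HN _|exact: pre_cover HN _].
by rewrite !deriveE// linearP.
Qed.

Lemma componentsZ c (p : N) (a : R) (v : tangent p) : atlas N c -> cdom c p ->
  components c (a *: v : tangent p) = a *: components c v.
Proof.
move=> Ac cp; have L := components_linear Ac cp.
by have := L a v 0; rewrite /= !addr0 [X in _ + X]/components derive0 addr0.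
Qed.

Lemma componentsD c (p : N) (u v : tangent p) : atlas N c -> cdom c p ->
  components c (u + v : tangent p) = components c u + components c v.
Proof.
move=> Ac cp; have L := components_linear Ac cp.
by have := L 1 u v; rewrite /= !scale1r.
Qed.

Lemma components0 c (p : N) : components c (0 : tangent p) = 0.
Proof. exact: derive0. Qed.

Lemma of_components_sum c (p : N) (w : 'rV[R]_n) : atlas N c -> cdom c p ->
  of_components c p w =
  \sum_i w 0 i *: (of_components c p (delta_mx 0 i) : 'rV[R]_n).
Proof.
move=> Ac cp; rewrite /of_components.
have d : differentiable (cphi (chart_at p) \o cinv c) (cphi c p).
  by apply: transition_differentiable => //;
    [exact: pre_chart_at HN _|exact: pre_cover HN _].
rewrite deriveE// [X in 'd _ _ X]row_sum_delta linear_sum.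
by apply: eq_bigr => i _; rewrite linearZ/= deriveE.
Qed.

Lemma smooth_fieldD (X Y : forall p : N, tangent p) :
  smooth_field X -> smooth_field Y ->
  smooth_field (fun p => X p + Y p : tangent p).
Proof.
move=> sX sY c Ac; have oc := open_cdom (chartN Ac).
apply: (smooth_on_ext HN oc _ (smooth_onD HN oc (sX c Ac) (sY c Ac))) => p cp.
by rewrite componentsD.
Qed.

Lemma smooth_fieldZ (f : N -> R) (X : forall p : N, tangent p) :
  smooth f -> smooth_field X ->
  smooth_field (fun p => f p *: X p : tangent p).
Proof.
move=> sf sX c Ac; have oc := open_cdom (chartN Ac).
have sf' : smooth_on (cdom c) f.
  exact: (smooth_on_sub HN openT oc (@subsetT _ _) sf).
apply: (smooth_on_ext HN oc _ (smooth_onZ HN oc sf' (sX c Ac))) => p cp.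
by rewrite componentsZ.
Qed.

Lemma smooth_field0 : smooth_field (fun p : N => 0 : tangent p).
Proof.
move=> c Ac; have oc := open_cdom (chartN Ac).
apply: (smooth_on_ext HN oc _ (smooth_on_cst HN 0 oc)) => p cp.
by rewrite components0.
Qed.

Lemma smooth_field_sum m (X : 'I_m -> forall p : N, tangent p) (s : seq 'I_m) :
  (forall i, smooth_field (X i)) ->
  smooth_field (fun p => \sum_(i <- s) X i p : tangent p).
Proof.
move=> sX; elim: s => [|i s IH].
  have -> : (fun p : N => \sum_(i <- [::]) X i p : tangent p) = fun=> 0.
    by apply/functional_extensionality_dep => p; rewrite big_nil.
  exact: smooth_field0.
have -> : (fun p : N => \sum_(j <- i :: s) X j p : tangent p) =
    fun p => X i p + \sum_(j <- s) X j p : tangent p.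
  by apply/functional_extensionality_dep => p; rewrite big_cons.
exact: (smooth_fieldD (sX i) IH).
Qed.

(** In a second chart a coordinate field has as components a directional derivative of the
    transition map, which is smooth; off [K] the cut-off field is 0. *)
Lemma smooth_frame c (phi : N -> R) (K : set N) w : atlas N c -> smooth phi ->
  closed K -> K `<=` cdom c -> (forall p, ~ K p -> phi p = 0) ->
  smooth_field (fun p => phi p *: of_components c p w : tangent p).
Proof.
move=> Ac sphi cK Kc phi0 c' Ac'.
have oc := open_cdom (chartN Ac); have oc' := open_cdom (chartN Ac').
have oI : open (cdom c `&` cdom c') by exact: openI.
apply: (smooth_on_local HN) => // p cp'.
have [cp|cp] := pselect (cdom c p).
  exists (cdom c `&` cdom c'); split => //.
  have sD : smooth_on (cdom c `&` cdom c')
      (fun p => 'D_w (cphi c' \o cinv c) (cphi c p)).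
    apply: (smooth_on_chart HN Ac oI
      (g := fun x => 'D_w (cphi c' \o cinv c) x)) => [q []//|k].
    by have [_ /(_ w)] := pre_transition HN Ac Ac' k.+1.
  have sphi' : smooth_on (cdom c `&` cdom c') phi.
    exact: (smooth_on_sub HN openT oI (@subsetT _ _) sphi).
  apply: (smooth_on_ext HN oI _ (smooth_onZ HN oI sphi' sD)) => q [cq cq'].
  rewrite (componentsZ (phi q) (of_components c q w) Ac' cq').
  by rewrite (components_of w Ac Ac' cq cq').
have oKc : open (~` K `&` cdom c') by apply: openI => //; exact: closed_openC.
exists (~` K `&` cdom c'); split => //; first by split=> // /Kc.
apply: (smooth_on_ext HN oKc _ (smooth_on_cst HN 0 oKc)) => q [Kq _].
by rewrite phi0// scale0r components0.
Qed.

Lemma smooth_cutoff (phi : N -> R) (K U : set N)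
    (f : N -> R) : smooth phi -> open U ->
  closed K -> K `<=` U -> (forall p, ~ K p -> phi p = 0) ->
  smooth_on U f -> smooth (fun p => phi p * f p).
Proof.
move=> sphi oU cK KU phi0 sf.
apply: (smooth_on_local HN) => [|p _]; first exact: openT.
have [Up|Up] := pselect (U p).
  exists U; split => //; apply: (smooth_onM HN) => //.
  exact: (smooth_on_sub HN openT oU (@subsetT _ _) sphi).
have oK := closed_openC cK.
exists (~` K); split => //; first by move=> /KU.
apply: (smooth_on_ext HN oK _ (smooth_on_cst HN 0 oK)) => q Kq.
by rewrite phi0// mul0r.
Qed.

Lemma smooth_coord c (X : forall p : N, tangent p) i : atlas N c ->
  smooth_field X -> smooth_on (cdom c) (fun p => components c (X p) 0 i).
Proof.
move=> Ac sX; have oc := open_cdom (chartN Ac).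
by have /(smooth_on_rowP HN _ oc) := sX c Ac; exact.
Qed.

(** The coefficient of the remainder in [field_decomposition]. The square arises because one factor
    [phi] globalizes the coefficients and another one the frame. *)
Lemma smoothB_sqr (phi : N -> R) : smooth phi ->
  smooth (fun p => 1 - phi p * phi p).
Proof.
move=> sphi; have oT := @openT N.
have H := smooth_onD HN oT (smooth_on_cst HN (1 : R) oT)
  (smooth_onM HN oT (smooth_on_cst HN (- 1 : R) oT)
    (smooth_onM HN oT sphi sphi)).
by apply: (smooth_on_ext HN oT _ H) => p _; rewrite mulN1r.
Qed.

(* Replaces the local frame of a chart by globally defined fields, so that the
   connection can be expanded without having been localized first. *)
Lemma field_decomposition c (phi : N -> R) (K : set N)
    (X : forall p : N, tangent p) : atlas N c ->
  K `<=` cdom c -> (forall p, ~ K p -> phi p = 0) ->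
  X = fun p => (1 - phi p * phi p) *: X p +
    \sum_i (phi p * components c (X p) 0 i) *:
           (phi p *: of_components c p (delta_mx 0 i)) : tangent p.
Proof.
move=> Ac Kc phi0; apply/functional_extensionality_dep => p.
have [cp|cp] := pselect (cdom c p); last first.
  have -> : phi p = 0 by apply: phi0 => /Kc.
  rewrite mul0r subr0 scale1r big1 ?addr0// => i _.
  by rewrite scale0r scaler0.
under eq_bigr do rewrite scalerA mulrAC -scalerA.
rewrite -scaler_sumr.
rewrite -(of_components_sum (components c (X p)) Ac cp).
by rewrite componentsK// -scalerDl subrK scale1r.
Qed.

End TangentVectors.

(** * Pointwise dependence of connections *)

Section Connections.
Context {R : realType} {n : nat} (N : charted R n).
Hypothesis HN : is_premanifold N.
Local Notation field := (forall p : N, tangent p).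
Variable nabla : field -> field -> field.
Hypothesis Hnabla : is_connection nabla.
Let chartN c := @pre_chart _ _ _ HN c.

Let smooth0 : smooth (fun _ : N => 0 : R).
Proof. exact: (smooth_on_cst HN (0 : R) openT). Qed.

Lemma lie_cst (X : field) (a : R) q : lie X (fun=> a) q = 0.
Proof. exact: derive_cst. Qed.

Lemma conn0l (Y : field) q : smooth_field Y ->
  nabla (fun p => 0 : tangent p) Y q = 0.
Proof.
move=> sY; have := conn_scalel Hnabla smooth0 (smooth_field0 HN) sY q.
by rewrite !scale0r.
Qed.

Lemma conn0r (X : field) q : smooth_field X ->
  nabla X (fun p => 0 : tangent p) q = 0.
Proof.
move=> sX; have := conn_leibniz Hnabla smooth0 sX (smooth_field0 HN) q.
by rewrite lie_cst !scale0r addr0.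
Qed.

Lemma conn_suml m (X : 'I_m -> field) (Y : field) q :
  (forall i, smooth_field (X i)) -> smooth_field Y ->
  nabla (fun p => \sum_i X i p : tangent p) Y q = \sum_i nabla (X i) Y q.
Proof.
move=> sX sY; elim: (index_enum _) => [|i s IH].
  rewrite big_nil -[RHS](conn0l q sY); congr (nabla _ Y q).
  by apply/functional_extensionality_dep => p; rewrite big_nil.
rewrite big_cons -IH.
apply: etrans (conn_addl Hnabla (sX i) (smooth_field_sum HN s sX) sY q).
congr (nabla _ Y q).
by apply/functional_extensionality_dep => p; rewrite big_cons.
Qed.

Lemma conn_sumr m (X : field) (Y : 'I_m -> field) q :
  smooth_field X -> (forall i, smooth_field (Y i)) ->
  nabla X (fun p => \sum_i Y i p : tangent p) q = \sum_i nabla X (Y i) q.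
Proof.
move=> sX sY; elim: (index_enum _) => [|i s IH].
  rewrite big_nil -[RHS](conn0r q sX); congr (nabla X _ q).
  by apply/functional_extensionality_dep => p; rewrite big_nil.
rewrite big_cons -IH.
apply: etrans (conn_addr Hnabla sX (sY i) (smooth_field_sum HN s sY) q).
congr (nabla X _ q).
by apply/functional_extensionality_dep => p; rewrite big_cons.
Qed.

(** All coefficients in the decomposition of [X] vanish at [q]: the components because [X q] is 0,
    and 1 - phi^2 because [phi q] is 1. *)
Lemma conn_eq0l (X Y : field) q : smooth_field X -> smooth_field Y ->
  X q = 0 -> nabla X Y q = 0.
Proof.
move=> sX sY Xq0; have Ac := pre_chart_at HN q; have cq := pre_cover HN q.
set c := chart_at q in Ac cq.
have [phi [K [sphi phi1 cK Kc phi0]]] := bump HN Ac cq.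
have phiq : phi q = 1 by exact: nbhs_singleton phi1.
rewrite (field_decomposition HN X Ac Kc phi0).
have sf i : smooth_field
    (fun p => phi p *: of_components c p (delta_mx 0 i) : tangent p).
  exact: (smooth_frame HN _ Ac sphi cK Kc phi0).
have sg i : smooth (fun p => phi p * components c (X p) 0 i).
  exact: (smooth_cutoff HN sphi (open_cdom (chartN Ac)) cK Kc phi0
    (smooth_coord HN i Ac sX)).
have sB := smoothB_sqr HN sphi.
have sS i := smooth_fieldZ HN (sg i) (sf i).
have sZ := smooth_fieldZ HN sB sX.
apply: etrans (conn_addl Hnabla sZ (smooth_field_sum HN _ sS) sY q) _.
rewrite (conn_scalel Hnabla sB sX sY) (conn_suml q sS sY).
rewrite phiq mulr1 subrr scale0r add0r.
apply: big1 => i _; rewrite (conn_scalel Hnabla (sg i) (sf i) sY).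
by rewrite Xq0 components0 mxE mulr0 scale0r.
Qed.

(* Expanding [Z] in a frame, the Leibniz rule leaves at a zero of [Z] only the
   derivatives of the components. *)
Lemma conn_eq0r (X Z : field) q : smooth_field X -> smooth_field Z ->
  Z q = 0 ->
  nabla X Z q =
    'D_(X q) (fun x => components (chart_at q) (Z (cinv (chart_at q) x)))
      (cphi (chart_at q) q).
Proof.
move=> sX sZ Zq0; have Ac := pre_chart_at HN q; have cq := pre_cover HN q.
set c := chart_at q in Ac cq *; have cc := chartN Ac.
have [phi [K [sphi phi1 cK Kc phi0]]] := bump HN Ac cq.
have phiq : phi q = 1 by exact: nbhs_singleton phi1.
rewrite [in LHS](field_decomposition HN Z Ac Kc phi0).
have sf i : smooth_field
    (fun p => phi p *: of_components c p (delta_mx 0 i) : tangent p).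
  exact: (smooth_frame HN _ Ac sphi cK Kc phi0).
have sg i : smooth (fun p => phi p * components c (Z p) 0 i).
  exact: (smooth_cutoff HN sphi (open_cdom cc) cK Kc phi0
    (smooth_coord HN i Ac sZ)).
have sB := smoothB_sqr HN sphi.
have sS i := smooth_fieldZ HN (sg i) (sf i).
have sBZ := smooth_fieldZ HN sB sZ.
apply: etrans (conn_addr Hnabla sX sBZ (smooth_field_sum HN _ sS) q) _.
rewrite (conn_leibniz Hnabla sB sX sZ) (conn_sumr q sX sS).
(* The remainder drops out: of its two Leibniz terms, one carries [Z q] and the other 1 - phi^2 at
   [q]. *)
rewrite Zq0 phiq mulr1 subrr scaler0 scale0r !add0r.
have dZ : differentiable (fun x => components c (Z (cinv c x))) (cphi c q).
  have [+ _] := sZ c Ac c Ac 1%N.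
  by apply; exists q => //; split.
rewrite [RHS]row_sum_delta; apply: eq_bigr => i _.
rewrite (conn_leibniz Hnabla (sg i) sX (sf i)).
rewrite Zq0 components0 mxE mulr0 scale0r addr0 phiq scale1r.
rewrite (of_components_chart_at HN); congr (_ *: _).
rewrite derive_row//; apply: near_eq_derive.
(* Under a derivative, [phi] has to be 1 on a whole neighbourhood of [q]. *)
have /(near_cphi cc cq) : \forall p \near q, phi p = 1 by [].
by apply: filterS => x /= ->; rewrite mul1r.
Qed.

Lemma conn_linearl (a : R) (X X' Y : field) q :
  smooth_field X -> smooth_field X' -> smooth_field Y ->
  nabla (fun p => a *: X p + X' p : tangent p) Y q =
  a *: nabla X Y q + nabla X' Y q.
Proof.
move=> sX sX' sY; have sa : smooth (fun _ : N => a).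
  exact: (smooth_on_cst HN a openT).
rewrite (conn_addl Hnabla (smooth_fieldZ HN sa sX) sX' sY q).
by rewrite (conn_scalel Hnabla sa sX sY q).
Qed.

Lemma conn_linearr (a : R) (X Y Y' : field) q :
  smooth_field X -> smooth_field Y -> smooth_field Y' ->
  nabla X (fun p => a *: Y p + Y' p : tangent p) q =
  a *: nabla X Y q + nabla X Y' q.
Proof.
move=> sX sY sY'; have sa : smooth (fun _ : N => a).
  exact: (smooth_on_cst HN a openT).
rewrite (conn_addr Hnabla sX (smooth_fieldZ HN sa sY) sY' q).
by rewrite (conn_leibniz Hnabla sa sX sY q) lie_cst scale0r add0r.
Qed.

Lemma smooth_fieldB (X Y : field) : smooth_field X -> smooth_field Y ->
  smooth_field (fun p => X p + -1 *: Y p : tangent p).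
Proof.
move=> sX sY; have s1 : smooth (fun _ : N => -1 : R).
  exact: (smooth_on_cst HN (-1 : R) openT).
exact: (smooth_fieldD HN sX (smooth_fieldZ HN s1 sY)).
Qed.

Lemma conn_congl (X X' Y : field) q :
  smooth_field X -> smooth_field X' -> smooth_field Y -> X q = X' q ->
  nabla X Y q = nabla X' Y q.
Proof.
move=> sX sX' sY XX'; have sD := smooth_fieldB sX sX'.
have -> : X = fun p => X' p + (X p + -1 *: X' p) : tangent p.
  by apply/functional_extensionality_dep => p; rewrite scaleN1r addrC subrK.
rewrite (conn_addl Hnabla sX' sD sY q) (conn_eq0l sD sY) ?addr0//.
by rewrite XX' scaleN1r subrr.
Qed.

(** [conn_eq0r] for the difference of [Y] and [Y']: the failure of tensoriality in the second
    argument becomes an explicit derivative. *)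
Lemma conn_congr (X Y Y' : field) q :
  smooth_field X -> smooth_field Y -> smooth_field Y' -> Y q = Y' q ->
  nabla X Y q = nabla X Y' q +
    'D_(X q) (fun x => let p := cinv (chart_at q) x in
                components (chart_at q) (Y p + -1 *: Y' p : tangent p))
      (cphi (chart_at q) q).
Proof.
move=> sX sY sY' YY'; have sD := smooth_fieldB sY sY'.
have {1}-> : Y = fun p => Y' p + (Y p + -1 *: Y' p) : tangent p.
  by apply/functional_extensionality_dep => p; rewrite scaleN1r addrC subrK.
rewrite (conn_addr Hnabla sX sY' sD q) (conn_eq0r sX sD)//.
by rewrite YY' scaleN1r subrr.
Qed.

End Connections.

(** * The product of the line with a manifold *)

Section LineProduct.
Context {R : realType} {n : nat} (M : charted R n).
Hypothesis HM : is_premanifold M.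
Let chartM c := @pre_chart _ _ _ HM c.

Lemma line_prod_hausdorff : hausdorff_space (line_prod M).
Proof.
move=> [a p] [b q] cl; congr pair.
  apply: (@Rhausdorff R) => A B aA bB.
  have nA : nbhs (a, p) [set r : R * M | A r.1] by exact: cvg_fst.
  have nB : nbhs (b, q) [set r : R * M | B r.1] by exact: cvg_fst.
  by have [r [rA rB]] := cl _ _ nA nB; exists r.1.
apply: (pre_hausdorff HM) => A B pA qB.
have nA : nbhs (a, p) [set r : R * M | A r.2] by exact: cvg_snd.
have nB : nbhs (b, q) [set r : R * M | B r.2] by exact: cvg_snd.
by have [r [rA rB]] := cl _ _ nA nB; exists r.2.
Qed.

Lemma open_snd (U : set M) : open U -> open [set q : line_prod M | U q.2].
Proof.
move=> oU; rewrite (_ : [set q | _] = (@snd R M) @^-1` U)//.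
by apply: open_comp => // q _; exact: cvg_snd.
Qed.

Lemma line_chart_image (c : chart R n M) (U : set M) :
  cphi (line_chart c) @` [set q | U q.2] = rsubmx @^-1` (cphi c @` U).
Proof.
apply/seteqP; split=> [_ [[t p] Up <-]|x [p Up px]] /=.
  by rewrite row_mxKr; exists p.
exists (lsubmx x 0 0, p) => //=.
by rewrite -[RHS]hsubmxK px; congr row_mx; rewrite [RHS]mx11_scalar.
Qed.

Lemma open_rsubmx m (U : set 'rV[R]_m) : open U ->
  open [set x : 'rV[R]_(1 + m) | U (rsubmx x)].
Proof.
by move=> oU; apply: open_comp => // x _; exact: continuous_rsubmx.
Qed.

Lemma line_chart_is_chart (c : chart R n M) : is_chart c ->
  is_chart (line_chart c : chart R (1 + n) (line_prod M)).
Proof.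
move=> cc; have [oc oi cK _ _] := cc.
have oc' := open_snd oc.
have oi' : open (cphi (line_chart c) @` cdom (line_chart c)).
  by rewrite line_chart_image; exact: open_rsubmx.
split => //.
- by move=> [t p] cp /=; rewrite row_mxKl row_mxKr cK// !mxE eqxx mulr1n.
- rewrite continuous_open_subspace// => -[t p] /[!inE] cp.
  apply: continuous_rowP => i; case: (split_ordP i) => j ->.
    rewrite (_ : (fun _ => _) = fst); first exact: cvg_fst.
    by apply/funext => q; rewrite /= row_mxEl ord1 !mxE mulr1n.
  rewrite (_ : (fun _ => _) =
    (fun x : 'rV[R]_n => x 0 j) \o (cphi c \o snd)); last first.
    by apply/funext => q; rewrite /= row_mxEr.
  apply: continuous_comp; last exact: coord_continuous.
  apply: continuous_comp; first exact: cvg_snd.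
  exact: cphi_continuous.
- rewrite continuous_open_subspace// => x /[!inE].
  rewrite line_chart_image /= => cx.
  have cl := @continuous_lsubmx R 1 1 n x.
  have cr := @continuous_rsubmx R 1 1 n x.
  have H1 := continuous_comp cl (@coord_continuous _ _ _ 0 0 _).
  have H2 := continuous_comp cr (cinv_continuous cc cx).
  exact: (cvg_pair H1 H2).
Qed.

Lemma Ck_on_rsubmx k m (U : set 'rV[R]_(1 + m)) : open U ->
  Ck_on k U (rsubmx : 'rV[R]_(1 + m) -> 'rV[R]_m).
Proof. by move=> oU; apply: Ck_on_lin => //; exact: continuous_rsubmx. Qed.

Lemma Ck_on_lsubmx k m (U : set 'rV[R]_(1 + m)) : open U ->
  Ck_on k U (fun x => lsubmx x 0 0).
Proof.
move=> oU.
have /(Ck_on_rowP _ _ oU) :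
    Ck_on k U (lsubmx : 'rV[R]_(1 + m) -> 'rV[R]_1).
  by apply: Ck_on_lin => //; exact: continuous_lsubmx.
exact.
Qed.

Lemma Ck_on_row_mx k (V : normedModType R) m (U : set V) (f : V -> R)
    (g : V -> 'rV[R]_m) : open U ->
  Ck_on k U f -> Ck_on k U g -> Ck_on k U (fun x => row_mx (f x)%:M (g x)).
Proof.
move=> oU Cf /(Ck_on_rowP _ _ oU) Cg; apply/(Ck_on_rowP _ _ oU) => i.
case: (split_ordP i) => j ->.
  by apply: (Ck_on_ext oU _ Cf) => x _; rewrite row_mxEl ord1 mxE.
by apply: (Ck_on_ext oU _ (Cg j)) => x _; rewrite row_mxEr.
Qed.

Lemma line_prod_premanifold : is_premanifold (line_prod M).
Proof.
split.
- exact: line_prod_hausdorff.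
- by move=> _ [c Ac <-]; apply: line_chart_is_chart; exact: chartM.
- by move=> q; exists (chart_at q.2) => //; exact: pre_chart_at HM _.
- by move=> q; exact: pre_cover HM _.
- move=> _ _ [c Ac <-] [c' Ac' <-] k.
  have oU : open (cphi c @` (cdom c `&` cdom c')).
    exact: (open_cphi (chartM Ac) (open_cdom (chartM Ac'))).
  have oU' := open_rsubmx oU.
  rewrite (_ : cdom (line_chart c) `&` cdom (line_chart c') =
    [set q | (cdom c `&` cdom c') q.2])// line_chart_image.
  apply: Ck_on_row_mx => //; first exact: Ck_on_lsubmx.
  apply: (Ck_on_comp oU' oU (f := rsubmx) (g := cphi c' \o cinv c)) => //.
    exact: Ck_on_rsubmx.
  exact: pre_transition HM _ _ Ac Ac' k.
Qed.

Let HN := line_prod_premanifold.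

Lemma line_atlas c : atlas M c -> atlas (line_prod M) (line_chart c).
Proof. by move=> Ac; exists c. Qed.

Lemma smooth_on_snd m (U : set M) (f : M -> 'rV[R]_m) : open U ->
  smooth_on U f ->
  smooth_on (M := line_prod M) [set q | U q.2] (fun q => f q.2).
Proof.
move=> oU sf _ [c Ac <-] k.
have oc : open (cphi c @` (cdom c `&` U)) by exact: (open_cphi (chartM Ac)).
have oc' := open_rsubmx oc.
rewrite (_ : cdom (line_chart c) `&` _ = [set q | (cdom c `&` U) q.2])//.
rewrite line_chart_image.
apply: (Ck_on_comp oc' oc (f := rsubmx) (g := f \o cinv c)) => //.
  exact: Ck_on_rsubmx.
exact: sf.
Qed.

Lemma smooth_snd (f : M -> R) : smooth f ->
  smooth (fun q : line_prod M => f q.2).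
Proof.
move=> sf _ [c Ac <-] k.
have oc : open (cphi c @` (cdom c `&` setT)).
  by apply: (open_cphi (chartM Ac)); exact: openT.
have oc' := open_rsubmx oc.
rewrite (_ : cdom (line_chart c) `&` _ = [set q | (cdom c `&` setT) q.2])//.
rewrite line_chart_image.
apply: (Ck_on_compR oc' oc (f := rsubmx) (g := f \o cinv c)) => //.
  exact: Ck_on_rsubmx.
exact: sf.
Qed.

(** In charts, restricting to a slice is composing with the affine map that prepends the constant
    [t]. *)
Lemma smooth_on_slice m t (U : set M) (f : line_prod M -> 'rV[R]_m) : open U ->
  smooth_on (M := line_prod M) [set q | U q.2] f ->
  smooth_on U (fun p => f (t, p)).
Proof.
move=> oU sf c Ac k.
have oc : open (cphi c @` (cdom c `&` U)) by exact: (open_cphi (chartM Ac)).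
have oc' := open_rsubmx oc.
have := sf _ (line_atlas Ac) k.
rewrite (_ : cdom (line_chart c) `&` _ = [set q | (cdom c `&` U) q.2])//.
rewrite line_chart_image => Cf.
have Cr : Ck_on k (cphi c @` (cdom c `&` U)) (fun x => row_mx t%:M x).
  apply: Ck_on_row_mx => //; first exact: Ck_on_cst.
  by apply: (Ck_on_lin k (f := idfun)) => // x; exact: cvg_id.
have H : forall x, (cphi c @` (cdom c `&` U)) x ->
    [set x | (cphi c @` (cdom c `&` U)) (rsubmx x)] (row_mx t%:M x).
  by move=> x Ux /=; rewrite row_mxKr.
apply: (Ck_on_ext oc _ (Ck_on_comp oc oc' H Cr Cf)) => x _ /=.
by rewrite row_mxKl row_mxKr mxE eqxx mulr1n.
Qed.

(** The two difference quotients are the same function of h. The base point stays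
    [cinv c (cphi c q.2)], as [q.2] may lie outside the domain of [c]. *)
Lemma derive_time (W : normedModType R) (F : line_prod M -> W)
    (c : chart R n M)
    (q : line_prod M) :
  'D_(row_mx 1%:M 0) (F \o cinv (line_chart c)) (cphi (line_chart c) q) =
  derive1 (fun t : R => F (t, cinv c (cphi c q.2))) q.1.
Proof.
rewrite /derive /derive1; set d := (fun _ : R => _); set d' := (fun _ : R => _).
suff -> : d = d' by []; apply/funext => h; rewrite /d /d' /=.
rewrite !linearD/= !linearZ/= !row_mxKl !row_mxKr scaler0 add0r !mxE eqxx.
by rewrite !mulr1n mulr1.
Qed.

Lemma derive_space (W : normedModType R) (F : line_prod M -> W)
    (c : chart R n M)
    (q : line_prod M) (v : 'rV[R]_n) :
  'D_(row_mx 0 v) (F \o cinv (line_chart c)) (cphi (line_chart c) q) =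
  'D_v (fun x => F (q.1, cinv c x)) (cphi c q.2).
Proof.
rewrite /derive; set d := (fun _ : R => _); set d' := (fun _ : R => _).
suff -> : d = d' by []; apply/funext => h; rewrite /d /d' /=.
rewrite !linearD/= !linearZ/= !row_mxKl !row_mxKr scaler0 add0r !mxE eqxx.
by rewrite !mulr1n.
Qed.

Lemma lie_ddt (g : line_prod M -> R) q : lie (@ddt R n M) g q = dot_fun g q.
Proof.
rewrite /lie /ddt derive_time (cphiK (chartM (pre_chart_at HM q.2)))//.
exact: pre_cover HM _.
Qed.

Lemma lie_td_lift X (g : line_prod M -> R) q :
  lie (td_lift X) g q = td_lie X g q.
Proof. by rewrite /lie /td_lift derive_space /td_lie /lie /freeze; case: q. Qed.

(** The Jacobian of a product coordinate change is block diagonal, with 1 in the time block. *)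
Lemma components_line c (q : line_prod M) (v : tangent q) :
  atlas M c -> cdom c q.2 ->
  components (line_chart c : chart R (1 + n) (line_prod M)) v =
  row_mx (lsubmx v) (components c (rsubmx v : tangent (q.2 : M))).
Proof.
move=> Ac cq; have Ac0 := pre_chart_at HM q.2; have cq0 := pre_cover HM q.2.
have d := transition_differentiable HN (line_atlas Ac0) (line_atlas Ac) cq0 cq.
rewrite /components /=; apply/rowP => i; rewrite derive_row//.
case: (split_ordP i) => j ->.
  rewrite row_mxEl ord1.
  rewrite (_ : (fun _ => _) =
    (fun x : 'rV[R]_1 => x 0 0) \o lsubmx); last first.
    by apply/funext => x; rewrite /= row_mxEl mxE eqxx mulr1n.
  have dl : differentiable (lsubmx : 'rV[R]_(1 + n) -> 'rV[R]_1)
      (row_mx (q.1)%:M (cphi (chart_at q.2) q.2)).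
    exact: differentiable_lsubmx.
  rewrite derive_comp//; last exact: differentiable_coord.
  rewrite -(derive_row (f := idfun)) ?derive_id//.
  by rewrite deriveE// diff_lin//; exact: continuous_lsubmx.
rewrite row_mxEr.
pose g := cphi c \o cinv (chart_at q.2).
rewrite (_ : (fun _ => _) = (fun x => (g \o rsubmx) x 0 j)); last first.
  by apply/funext => x; rewrite /= row_mxEr.
have dr : differentiable (rsubmx : 'rV[R]_(1 + n) -> 'rV[R]_n)
    (row_mx (q.1)%:M (cphi (chart_at q.2) q.2)).
  exact: differentiable_rsubmx.
have dg : differentiable g (rsubmx (row_mx (q.1)%:M (cphi (chart_at q.2) q.2))).
  by rewrite row_mxKr; exact: (transition_differentiable HM).
have Dr : 'D_v rsubmx (row_mx (q.1)%:M (cphi (chart_at q.2) q.2)) =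
    rsubmx v :> 'rV[R]_n.
  by rewrite deriveE// diff_lin//; exact: continuous_rsubmx.
rewrite -(derive_row _ _ (differentiable_comp dr dg)) (derive_comp v dr dg) Dr.
by rewrite row_mxKr.
Qed.

End LineProduct.

(** * Time-dependent fields, their lifts and smoothness criteria for tensors *)

Section TimeDependentFields.
Context {R : realType} {n : nat} (M : charted R n).
Hypothesis HM : is_premanifold M.
Let chartM c := @pre_chart _ _ _ HM c.
Let HN := line_prod_premanifold HM.
Local Notation field := (forall p : M, tangent p).
Local Notation td_field := (forall q : line_prod M, tangent (q.2 : M)).

Let open_tube c : atlas M c -> open [set q : line_prod M | cdom c q.2].
Proof. by move=> Ac; apply: open_snd; exact: (open_cdom (chartM Ac)). Qed.

Lemma components_lift c (X : td_field) (q : line_prod M) :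
  atlas M c -> cdom c q.2 ->
  components (line_chart c : chart R (1 + n) (line_prod M)) (td_lift X q) =
  row_mx 0 (components c (X q)).
Proof.
move=> Ac cq; rewrite (components_line HM (td_lift X q) Ac cq).
by rewrite /td_lift row_mxKl row_mxKr.
Qed.

Lemma smooth_td_lift (X : td_field) : td_smooth_field X ->
  smooth_field (td_lift X).
Proof.
move=> sX _ [c Ac <-]; have oc := open_tube Ac.
apply/(smooth_on_rowP HN _ oc) => i; case: (split_ordP i) => j ->.
  apply: (smooth_on_ext HN oc _ (smooth_on_cst HN (0 : R) oc)) => q cq.
  by rewrite components_lift// row_mxEl mxE.
have /(smooth_on_rowP HN _ oc)/(_ j) := sX c Ac.
apply: (smooth_on_ext HN oc) => q cq.
by rewrite components_lift// row_mxEr.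
Qed.

Lemma smooth_ddt : smooth_field (@ddt R n M).
Proof.
move=> _ [c Ac <-]; have oc := open_tube Ac.
apply: (smooth_on_ext HN oc _ (smooth_on_cst HN (row_mx 1%:M 0) oc)) => q cq.
rewrite (components_line HM (ddt q) Ac cq) /ddt row_mxKl row_mxKr.
by rewrite components0.
Qed.

Lemma smooth_field_space (V : forall q : line_prod M, tangent q) :
  smooth_field V -> td_smooth_field (fun q => rsubmx (V q) : tangent (q.2 : M)).
Proof.
move=> sV c Ac; have oc := open_tube Ac.
apply/(smooth_on_rowP HN _ oc) => j.
have /(smooth_on_rowP HN _ oc)/(_ (rshift 1 j)) := sV _ (line_atlas Ac).
apply: (smooth_on_ext HN oc) => q cq.
by rewrite (components_line HM (V q) Ac cq) row_mxEr.
Qed.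

(** The d/dt-component is the same in all product charts, so its smoothness in each of them makes it
    a globally smooth function. *)
Lemma smooth_field_time (V : forall q : line_prod M, tangent q) :
  smooth_field V -> smooth (fun q => lsubmx (V q) 0 0).
Proof.
move=> sV; apply: (smooth_on_local HN) => [|q0 _]; first exact: openT.
have Ac := pre_chart_at HM q0.2; have oc := open_tube Ac.
exists [set q | cdom (chart_at q0.2) q.2]; split => //.
  exact: pre_cover HM _.
have /(smooth_on_rowP HN _ oc)/(_ (lshift n ord0)) := sV _ (line_atlas Ac).
apply: (smooth_on_ext HN oc) => q cq.
by rewrite (components_line HM (V q) Ac cq) row_mxEl.
Qed.

Lemma td_smooth_snd (X : field) : smooth_field X ->
  td_smooth_field (fun q => X q.2).
Proof.
move=> sX c Ac.
exact: (smooth_on_snd HM (open_cdom (chartM Ac)) (sX c Ac)).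
Qed.

Lemma smooth_freeze t (X : td_field) : td_smooth_field X ->
  smooth_field (freeze t X).
Proof.
move=> sX c Ac.
exact: (smooth_on_slice HM t (open_cdom (chartM Ac)) (sX c Ac)).
Qed.

(** The preferred chart depends only on [p], so along the curve s -> (s, p) the values of [X] are
    their own components in one fixed chart. *)
Lemma td_field_differentiable (X : td_field) t (p : M) : td_smooth_field X ->
  differentiable (fun s : R => X (s, p) : 'rV[R]_n) t.
Proof.
move=> sX; have Ac := pre_chart_at HM p; have cp := pre_cover HM p.
have [+ _] := sX _ Ac _ (line_atlas Ac) 1%N.
move=> /(_ (cphi (line_chart (chart_at p)) (t, p))) dX.
have {}dX : differentiable
   ((fun q : line_prod M => components (chart_at p) (X q)) \o
      cinv (line_chart (chart_at p))) (row_mx t%:M (cphi (chart_at p) p)).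
  by apply: dX; exists (t, p).
have Cr : Ck_on 1 setT (fun s : R => row_mx s%:M (cphi (chart_at p) p)).
  have oT : open [set: R] := openT.
  apply: Ck_on_row_mx => //; last exact: Ck_on_cst.
  by apply: (Ck_on_lin 1 (f := idfun)) => // x; exact: cvg_id.
have [/(_ t I) dr _] := Cr.
have := differentiable_comp dr dX; congr (differentiable _ _).
apply/funext => s /=.
rewrite row_mxKl row_mxKr (cphiK (chartM Ac) cp) mxE eqxx mulr1n.
exact: (components_chart_at HM (X (s, p))).
Qed.

(** Coordinate expression of a lift in the preferred chart at [q]; its derivative is the correction
    term when the second argument of the connection is exchanged. *)
Definition lift_coord (Z : td_field) (q : line_prod M) (x : 'rV[R]_(1 + n)) :=
  components (chart_at q) (td_lift Z (cinv (chart_at q) x)).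

Lemma derive_lift_time (Z : td_field) (q : line_prod M) v :
  td_smooth_field Z ->
  lsubmx ('D_v (lift_coord Z q) (cphi (chart_at q) q)) = 0.
Proof.
move=> sZ; have Ac := pre_chart_at HM q.2; have cq := pre_cover HM q.2.
have [+ _] := smooth_td_lift sZ (line_atlas Ac) (line_atlas Ac) 1%N.
move=> /(_ (cphi (chart_at q) q)) dZ.
have {}dZ : differentiable (lift_coord Z q) (cphi (chart_at q) q).
  by apply: dZ; exists q.
apply/rowP => j; rewrite !mxE (derive_row _ _ dZ).
rewrite -[RHS](derive_cst (0 : R) (cphi (chart_at q) q) v).
apply: near_eq_derive.
have : \forall r \near q, cdom (chart_at q.2) r.2.
  by apply: open_nbhs_nbhs; split=> //; exact: open_tube.
move=> /(near_cphi (pre_chart HN (line_atlas Ac)) cq); apply: filterS => x cx.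
rewrite /lift_coord (components_lift Z Ac cx).
by rewrite row_mxEl mxE.
Qed.

Lemma derive_lift_ddt (Z : td_field) (q : line_prod M) :
  td_smooth_field Z ->
  'D_(ddt q) (lift_coord Z q) (cphi (chart_at q) q) = row_mx 0 (dot_field Z q).
Proof.
move=> sZ.
have Ac := pre_chart_at HM q.2; have cq := pre_cover HM q.2.
rewrite (derive_time (fun r : line_prod M =>
  components (chart_at q) (td_lift Z r))).
rewrite (_ : (fun t : R => _) =
  fun t => row_mx 0 (Z (t, q.2) : 'rV[R]_n)); last first.
  apply/funext => t; rewrite (cphiK (chartM Ac) cq).
  rewrite (components_lift Z (q := (t, q.2)) Ac cq).
  by rewrite (components_chart_at HM (Z (t, q.2))).
have dZ := td_field_differentiable q.1 q.2 sZ.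
rewrite /dot_field !derive1E; apply/rowP => i.
have dr : differentiable
    (fun t : R => row_mx 0 (Z (t, q.2) : 'rV[R]_n) : 'rV[R]_(1 + n)) q.1.
  apply/differentiable_rowP => k; case: (split_ordP k) => j ->.
    rewrite (_ : (fun _ => _) = cst (0 : R)); first exact: differentiable_cst.
    by apply/funext => t; rewrite row_mxEl mxE.
  rewrite (_ : (fun _ => _) = (fun t => (Z (t, q.2) : 'rV[R]_n) 0 j)).
    by have /differentiable_rowP := dZ; exact.
  by apply/funext => t; rewrite row_mxEr.
rewrite (derive_row _ _ dr); case: (split_ordP i) => j ->.
  rewrite row_mxEl mxE -[RHS](derive_cst (0 : R) q.1 (1 : R)).
  apply: near_eq_derive; apply: (@filterE _ (nbhs q.1)) => t.
  by rewrite row_mxEl mxE.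
rewrite row_mxEr (derive_row _ _ dZ).
by apply: near_eq_derive; apply: (@filterE _ (nbhs q.1)) => t; rewrite row_mxEr.
Qed.

(** Moving in the direction (0, v) never leaves the slice, where [Z] is 0. *)
Lemma derive_lift_slice (Z : td_field) (q : line_prod M) (v : 'rV[R]_n) :
  (forall p, Z (q.1, p) = 0) ->
  'D_(row_mx 0 v) (lift_coord Z q) (cphi (chart_at q) q) = 0.
Proof.
move=> Z0.
rewrite (derive_space (fun r : line_prod M =>
  components (chart_at q) (td_lift Z r))).
rewrite -[RHS](derive_cst (0 : 'rV[R]_(1 + n)) (cphi (chart_at q.2) q.2) v).
apply: near_eq_derive; apply: (@filterE _ (nbhs _)) => x.
rewrite /td_lift Z0 row_mx0.
exact: components0.
Qed.

Lemma exists_extension (p : M) (v : tangent p) :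
  exists E : field, smooth_field E /\ E p = v.
Proof.
have Ac := pre_chart_at HM p; have cp := pre_cover HM p.
have [phi [K [sphi phi1 cK Kc phi0]]] := bump HM Ac cp.
exists (fun r => phi r *: of_components (chart_at p) r v).
split; first exact: (smooth_frame HM v Ac sphi cK Kc phi0).
by rewrite (nbhs_singleton phi1) scale1r (of_components_chart_at HM).
Qed.

(** Smoothness of tensors is defined on vectors with constant components in a chart; locally these
    are values of a global time-independent field, so testing on such fields is enough. *)
Lemma exists_local_frame c (q0 : line_prod M) w : atlas M c -> cdom c q0.2 ->
  exists (E : field) (B : set (line_prod M)),
    [/\ smooth_field E, open B, B q0, B `<=` [set q | cdom c q.2] &
        forall q, B q -> of_components c q.2 w = E q.2].
Proof.
move=> Ac cq0; have [phi [K [sphi phi1 cK Kc phi0]]] := bump HM Ac cq0.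
exists (fun r => phi r *: of_components c r w).
have phi1c : nbhs q0.2 [set p | phi p = 1 /\ cdom c p].
  apply: filterI => //; apply: open_nbhs_nbhs; split=> //.
  exact: (open_cdom (chartM Ac)).
move: phi1c; rewrite nbhsE => -[B [oB Bq0] Bphi].
exists [set q | B q.2]; split => //.
- exact: (smooth_frame HM w Ac sphi cK Kc phi0).
- exact: open_snd.
- by move=> q /Bphi[].
- by move=> q /Bphi[-> _]; rewrite scale1r.
Qed.

Lemma td_form_smooth (a : forall q : line_prod M, tangent (q.2 : M) -> R) :
  (forall q, scalar (a q)) ->
  (forall E, smooth_field E -> smooth (fun q : line_prod M => a q (E q.2))) ->
  td_form a.
Proof.
move=> la sa; split=> // c Ac w; have oc := open_tube Ac.
apply: (smooth_on_local HN) => // q0 cq0.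
have [E [B [sE oB Bq0 Bc BE]]] := exists_local_frame w Ac cq0.
exists B; split => //.
have saB := smooth_on_sub HN openT oB (@subsetT _ _) (sa E sE).
apply: (smooth_on_ext HN oB _ saB).
by move=> q Bq; rewrite BE.
Qed.

Lemma td_covariant2_smooth
    (e : forall q : line_prod M, tangent (q.2 : M) -> tangent (q.2 : M) -> R) :
  (forall q, bilinear_for *%R *%R (e q)) ->
  (forall E F, smooth_field E -> smooth_field F ->
     smooth (fun q : line_prod M => e q (E q.2) (F q.2))) ->
  td_covariant2 e.
Proof.
move=> le se; split=> // c Ac w w'; have oc := open_tube Ac.
apply: (smooth_on_local HN) => // q0 cq0.
have [E [B [sE oB Bq0 Bc BE]]] := exists_local_frame w Ac cq0.
have [F [D [sF oD Dq0 Dc DF]]] := exists_local_frame w' Ac cq0.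
have oBD : open (B `&` D) by exact: openI.
exists (B `&` D); split => //.
have seBD := smooth_on_sub HN openT oBD (@subsetT _ _) (se E F sE sF).
apply: (smooth_on_ext HN oBD _ seBD).
by move=> q [Bq Dq]; rewrite BE// DF.
Qed.

Lemma td_endomorphism_smooth
    (A : forall q : line_prod M, tangent (q.2 : M) -> tangent (q.2 : M)) :
  (forall q, linear (A q)) ->
  (forall E, smooth_field E -> td_smooth_field (fun q => A q (E q.2))) ->
  td_endomorphism A.
Proof.
move=> lA sA; split=> // c Ac w; have oc := open_tube Ac.
apply: (smooth_on_local HN) => // q0 cq0.
have [E [B [sE oB Bq0 Bc BE]]] := exists_local_frame w Ac cq0.
exists B; split => //.
apply: (smooth_on_ext HN oB _ (smooth_on_sub HN oc oB Bc (sA E sE c Ac))).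
by move=> q Bq; rewrite BE.
Qed.

End TimeDependentFields.

(** * Splitting a connection on the product *)

Section Splitting.
Context {R : realType} {n : nat} (M : charted R n).
Hypothesis HM : is_premanifold M.
Local Notation td_field := (forall q : line_prod M, tangent (q.2 : M)).
Local Notation hat_field := (forall q : line_prod M, tangent q).
Variable nablahat : hat_field -> hat_field -> hat_field.
Hypothesis Hnabla : is_connection nablahat.
Let HN := line_prod_premanifold HM.

Lemma td_smoothB (Y Y' : td_field) : td_smooth_field Y -> td_smooth_field Y' ->
  td_smooth_field (fun q => Y q + -1 *: Y' q : tangent (q.2 : M)).
Proof.
move=> sY sY'.
have := smooth_field_space HM
  (smooth_fieldB HN (smooth_td_lift HM sY) (smooth_td_lift HM sY')).
congr td_smooth_field; apply/functional_extensionality_dep => q.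
by rewrite /td_lift linearD/= linearZ/= !row_mxKr.
Qed.

Lemma conn_lift (V : hat_field) (Y Y' : td_field) q :
  smooth_field V -> td_smooth_field Y -> td_smooth_field Y' -> Y q = Y' q ->
  nablahat V (td_lift Y) q = nablahat V (td_lift Y') q +
    'D_(V q) (lift_coord (fun r => Y r + -1 *: Y' r) q) (cphi (chart_at q) q).
Proof.
move=> sV sY sY' YY'.
have sL := smooth_td_lift HM sY; have sL' := smooth_td_lift HM sY'.
have LL' : td_lift Y q = td_lift Y' q by rewrite /td_lift YY'.
rewrite (conn_congr HN Hnabla sV sL sL' LL').
apply: (f_equal (fun F : 'rV[R]_(1 + n) -> 'rV[R]_(1 + n) =>
  nablahat V (td_lift Y') q + 'D_(V q) F (cphi (chart_at q) q))).
apply/funext => x; rewrite /lift_coord /=.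
apply: (f_equal (fun v => components (chart_at q) v)).
by rewrite /td_lift scale_row_mx add_row_mx scaler0 addr0.
Qed.

Lemma conn_lift_time (V : hat_field) (Y Y' : td_field) q :
  smooth_field V -> td_smooth_field Y -> td_smooth_field Y' -> Y q = Y' q ->
  lsubmx (nablahat V (td_lift Y) q) = lsubmx (nablahat V (td_lift Y') q).
Proof.
move=> sV sY sY' YY'; rewrite (conn_lift sV sY sY' YY') linearD/=.
by rewrite (derive_lift_time HM q (V q) (td_smoothB sY sY')) addr0.
Qed.

Lemma conn_lift_slice (V : hat_field) (Y Y' : td_field) q v :
  smooth_field V -> td_smooth_field Y -> td_smooth_field Y' ->
  V q = row_mx 0 v -> (forall p, Y (q.1, p) = Y' (q.1, p)) ->
  nablahat V (td_lift Y) q = nablahat V (td_lift Y') q.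
Proof.
move=> sV sY sY' Vq YY'.
have YY'q : Y q = Y' q by case: q YY' {Vq} => t p /=.
have D0 p : Y (q.1, p) + -1 *: Y' (q.1, p) = 0 by rewrite YY' scaleN1r subrr.
by rewrite (conn_lift sV sY sY' YY'q) Vq (derive_lift_slice v D0) addr0.
Qed.

(** Since [E] is constant in time, the difference of [Y] and [E] has the same time derivative as
    [Y]. *)
Lemma conn_ddt_lift (Y : td_field) (E : forall p : M, tangent p) q :
  td_smooth_field Y -> smooth_field E -> Y q = E q.2 ->
  nablahat (@ddt R n M) (td_lift Y) q =
  nablahat (@ddt R n M) (td_lift (fun r => E r.2)) q + row_mx 0 (dot_field Y q).
Proof.
move=> sY sE YE; have sE' := td_smooth_snd HM sE.
rewrite (conn_lift (smooth_ddt HM) sY sE' YE).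
rewrite (derive_lift_ddt HM q (td_smoothB sY sE')).
apply: (f_equal (fun u : 'rV[R]_n => _ + row_mx 0 u)).
have dY := td_field_differentiable HM q.1 q.2 sY.
rewrite /dot_field !derive1E /=.
have := deriveB (diff_derivable dY)
  (@derivable_cst _ _ _ (E q.2 : 'rV[R]_n) q.1 (1 : R)).
rewrite derive_cst subr0 => <-.
apply: (f_equal (fun F : R -> 'rV[R]_n => 'D_(1 : R) F q.1)).
by apply/funext => t; rewrite scaleN1r.
Qed.

End Splitting.

(** * Tensors from arbitrary extensions, and the connection on the slices *)

Section Tensors.
Context {R : realType} {n : nat} (M : charted R n).
Hypothesis HM : is_premanifold M.
Local Notation field := (forall p : M, tangent p).
Local Notation td_field := (forall q : line_prod M, tangent (q.2 : M)).
Local Notation hat_field := (forall q : line_prod M, tangent q).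
Variable nablahat : hat_field -> hat_field -> hat_field.
Hypothesis Hnabla : is_connection nablahat.
Variable ext : forall p : M, tangent p -> field.
Hypothesis ext_smooth : forall p (v : tangent p), smooth_field (ext v).
Hypothesis ext_val : forall p (v : tangent p), ext v p = v.
Let HN := line_prod_premanifold HM.

Definition still (E : field) : td_field := fun q => E q.2.

Definition hat_ext (q : line_prod M) (v : tangent (q.2 : M)) : hat_field :=
  td_lift (still (ext v)).

Definition space_nabla (t : R) (X Y : field) (p : M) : tangent p :=
  rsubmx (nablahat (td_lift (still X)) (td_lift (still Y)) (t, p)).

Let sddt := smooth_ddt HM.

Let smooth_still_lift (E : field) :
  smooth_field E -> smooth_field (td_lift (still E)).
Proof. by move=> sE; exact: (smooth_td_lift HM (td_smooth_snd HM sE)). Qed.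

Lemma smooth_hat_ext q v : smooth_field (@hat_ext q v).
Proof. exact: smooth_still_lift. Qed.

Lemma hat_ext_val q v : @hat_ext q v q = row_mx 0 v.
Proof. by rewrite /hat_ext /td_lift /still ext_val. Qed.

Lemma td_lift_linear (a : R) (X Y : td_field) :
  td_lift (fun q => a *: X q + Y q : tangent (q.2 : M)) =
  fun q => a *: td_lift X q + td_lift Y q : tangent q.
Proof.
apply/functional_extensionality_dep => q.
by rewrite /td_lift scale_row_mx add_row_mx scaler0 addr0.
Qed.

Lemma nabla_lift_ddt (X : td_field) q : td_smooth_field X ->
  nablahat (td_lift X) (@ddt R n M) q =
  nablahat (hat_ext (X q)) (@ddt R n M) q.
Proof.
move=> sX.
have sX' := smooth_td_lift HM sX.
apply: (conn_congl HN Hnabla sX' (smooth_hat_ext (X q)) sddt).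
by rewrite hat_ext_val.
Qed.

Lemma nabla_ddt_lift (Y : td_field) q : td_smooth_field Y ->
  nablahat (@ddt R n M) (td_lift Y) q =
  nablahat (@ddt R n M) (hat_ext (Y q)) q + row_mx 0 (dot_field Y q).
Proof.
move=> sY.
by rewrite (conn_ddt_lift HM Hnabla sY (ext_smooth (Y q)) (esym (ext_val _))).
Qed.

Lemma dot_still (E : field) q : dot_field (still E) q = 0.
Proof. exact: (derive1_cst (E q.2 : 'rV[R]_n) q.1). Qed.

Lemma nabla_ddt_still (E : field) q : smooth_field E ->
  nablahat (@ddt R n M) (td_lift (still E)) q =
  nablahat (@ddt R n M) (hat_ext (E q.2)) q.
Proof.
move=> sE; rewrite (nabla_ddt_lift _ (td_smooth_snd HM sE)).
by rewrite dot_still row_mx0 addr0.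
Qed.

(** The second argument is exchanged first, at a cost without d/dt-part; the first argument is
    tensorial anyway. This is what makes epsilon a tensor. *)
Lemma nabla_lift_lift_time (X Y : td_field) q :
  td_smooth_field X -> td_smooth_field Y ->
  lsubmx (nablahat (td_lift X) (td_lift Y) q) =
  lsubmx (nablahat (hat_ext (X q)) (hat_ext (Y q)) q).
Proof.
move=> sX sY; have sX' := smooth_td_lift HM sX.
have sY' := td_smooth_snd HM (ext_smooth (Y q)).
have YE : Y q = still (ext (Y q)) q by rewrite /still ext_val.
rewrite (conn_lift_time HM Hnabla sX' sY sY' YE).
have XE : td_lift X q = hat_ext (X q) q by rewrite hat_ext_val.
by rewrite (conn_congl HN Hnabla sX' (smooth_hat_ext (X q))
  (smooth_hat_ext (Y q)) XE).
Qed.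

(** Freezing time keeps [X] at [q] and keeps [Y] on the whole slice through [q], which is all that
    the value at [q] depends on. *)
Lemma td_nabla_space (X Y : td_field) q :
  td_smooth_field X -> td_smooth_field Y ->
  td_nabla space_nabla X Y q = rsubmx (nablahat (td_lift X) (td_lift Y) q).
Proof.
case: q => t p sX sY; rewrite /td_nabla /space_nabla /=.
have sXt := smooth_still_lift (smooth_freeze HM t sX).
have sYt := td_smooth_snd HM (smooth_freeze HM t sY).
have Xq : td_lift (still (freeze t X)) (t, p) = td_lift X (t, p) by [].
have sX' := smooth_td_lift HM sX.
rewrite (conn_congl HN Hnabla sXt sX' (smooth_td_lift HM sYt) Xq).
by rewrite (conn_lift_slice HM Hnabla (q := (t, p)) (v := X (t, p)) sX' sYt sY).
Qed.

Lemma smooth_ext_comb p a (v w : tangent p) :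
  smooth_field (fun r => a *: ext v r + ext w r : tangent r).
Proof.
have sa : smooth (fun _ : M => a) by exact: (smooth_on_cst HM a openT).
exact: (smooth_fieldD HM (smooth_fieldZ HM sa (ext_smooth v)) (ext_smooth w)).
Qed.

(** [ext] itself need not be linear, but the extension of a combination and the combination of the
    extensions agree at [q]. *)
Lemma nabla_ext_ddt_linear q :
  linear (fun v => nablahat (@hat_ext q v) (@ddt R n M) q : 'rV[R]_(1 + n)).
Proof.
move=> a v w /=.
have sv := smooth_hat_ext (q := q) v; have sw := smooth_hat_ext (q := q) w.
rewrite -(conn_linearl HN Hnabla a q sv sw sddt).
have sE : smooth_field
    (fun r => a *: @hat_ext q v r + @hat_ext q w r : tangent r).
  rewrite /hat_ext -td_lift_linear.
  apply: (@smooth_still_lift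
    (fun r => a *: @ext q.2 v r + @ext q.2 w r : tangent r)).
  exact: (@smooth_ext_comb q.2 a v w).
apply: (conn_congl HN Hnabla (smooth_hat_ext (q := q) (a *: v + w)) sE sddt).
by rewrite !hat_ext_val scale_row_mx add_row_mx scaler0 addr0.
Qed.

(** Here the exchange is in the second argument; it is free because the combination of extensions is
    again time-independent. *)
Lemma nabla_ddt_ext_linear q :
  linear (fun v => nablahat (@ddt R n M) (@hat_ext q v) q : 'rV[R]_(1 + n)).
Proof.
move=> a v w /=.
have sv := smooth_hat_ext (q := q) v; have sw := smooth_hat_ext (q := q) w.
rewrite -(conn_linearr HN Hnabla a q sddt sv sw).
rewrite /hat_ext -td_lift_linear.
have := nabla_ddt_still q (@smooth_ext_comb q.2 a v w).
by rewrite /still !ext_val.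
Qed.

Lemma nabla_ext_ext_bilinear q :
  bilinear_for *%R *%R (fun v w =>
    lsubmx (nablahat (@hat_ext q v) (@hat_ext q w) q) 0 0 : R).
Proof.
have sh v := smooth_hat_ext (q := q) v.
split=> [w a v v'|v a w w'] /=.
  have := nabla_lift_lift_time q
    (td_smooth_snd HM (@smooth_ext_comb q.2 a v v'))
    (td_smooth_snd HM (@ext_smooth q.2 w)).
  rewrite /= !ext_val => <-.
  rewrite (td_lift_linear a (still (@ext q.2 v)) (still (@ext q.2 v'))).
  have -> := conn_linearl HN Hnabla a q (sh v) (sh v') (sh w).
  by rewrite !mxE.
have := nabla_lift_lift_time q (td_smooth_snd HM (@ext_smooth q.2 v))
    (td_smooth_snd HM (@smooth_ext_comb q.2 a w w')).
rewrite /= !ext_val => <-.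
rewrite (td_lift_linear a (still (@ext q.2 w)) (still (@ext q.2 w'))).
have -> := conn_linearr HN Hnabla a q (sh v) (sh w) (sh w').
by rewrite !mxE.
Qed.

(** Each axiom is that of [nablahat] on time-independent lifts. For the Leibniz rule, a function
    pulled back from M is differentiated by a lift exactly as on the slice. *)
Lemma td_connection_space : td_connection space_nabla.
Proof.
split=> [t|X Y sX sY]; last first.
  have -> : td_nabla space_nabla X Y =
      fun q => rsubmx (nablahat (td_lift X) (td_lift Y) q).
    by apply/functional_extensionality_dep => q; rewrite td_nabla_space.
  apply: (smooth_field_space HM).
  exact: (conn_smooth Hnabla (smooth_td_lift HM sX) (smooth_td_lift HM sY)).
split.
- move=> X Y sX sY.
  have sH := conn_smooth Hnabla (smooth_still_lift sX) (smooth_still_lift sY).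
  exact: (smooth_freeze HM t (smooth_field_space HM sH)).
- move=> X X' Y sX sX' sY p; rewrite /space_nabla.
  have := conn_linearl HN Hnabla 1 (t, p) (smooth_still_lift sX)
    (smooth_still_lift sX') (smooth_still_lift sY).
  rewrite -td_lift_linear scale1r => E.
  rewrite -linearD /= -E; congr (rsubmx (nablahat (td_lift _) _ _)).
  by apply/functional_extensionality_dep => q; rewrite scale1r.
- move=> f X Y sf sX sY p; rewrite /space_nabla.
  have := conn_scalel Hnabla (smooth_snd HM sf) (smooth_still_lift sX)
    (smooth_still_lift sY) (t, p).
  rewrite -linearZ /= => <-; congr (rsubmx (nablahat _ _ _)).
  apply/functional_extensionality_dep => q.
  by rewrite /td_lift scale_row_mx scaler0.
- move=> X Y Y' sX sY sY' p; rewrite /space_nabla.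
  have := conn_linearr HN Hnabla 1 (t, p) (smooth_still_lift sX)
    (smooth_still_lift sY) (smooth_still_lift sY').
  rewrite -td_lift_linear scale1r => E.
  rewrite -linearD /= -E; congr (rsubmx (nablahat _ (td_lift _) _)).
  by apply/functional_extensionality_dep => q; rewrite scale1r.
- move=> f X Y sf sX sY p; rewrite /space_nabla.
  have := conn_leibniz Hnabla (smooth_snd HM sf) (smooth_still_lift sX)
    (smooth_still_lift sY) (t, p).
  have -> : (fun q : line_prod M => f q.2 *: td_lift (still Y) q : tangent q) =
      td_lift (still (fun p => f p *: Y p)).
    apply/functional_extensionality_dep => q.
    by rewrite /td_lift scale_row_mx scaler0.
  move=> ->; rewrite lie_td_lift linearD/= !linearZ/=.
  by rewrite /td_lift row_mxKr.
Qed.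

End Tensors.

(** * Assembling the decomposition *)

Lemma hat_split (R : realType) (n : nat) (M : charted R n) (q : line_prod M)
    (u : tangent q) :
  u = lsubmx u 0 0 *: ddt q + row_mx 0 (rsubmx u).
Proof.
rewrite /ddt scale_row_mx scaler0 add_row_mx addr0 add0r.
by rewrite scale_scalar_mx mulr1 -mx11_scalar hsubmxK.
Qed.

Theorem theorem6p1 (R : realType) (n : nat) (M : charted R n)
    (nablahat : (forall q : line_prod M, tangent q) ->
                (forall q : line_prod M, tangent q) ->
                forall q : line_prod M, tangent q) :
  is_manifold M -> is_connection nablahat ->
  exists (lambda : line_prod M -> R)
         (alpha beta : forall q : line_prod M, tangent (q.2 : M) -> R)
         (eps : forall q : line_prod M,
                  tangent (q.2 : M) -> tangent (q.2 : M) -> R)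
         (C : forall q : line_prod M, tangent (q.2 : M))
         (A B : forall q : line_prod M,
                  tangent (q.2 : M) -> tangent (q.2 : M))
         (nabla : R -> (forall p : M, tangent p) ->
                  (forall p : M, tangent p) -> forall p : M, tangent p),
    smooth lambda /\ td_form alpha /\ td_form beta /\ td_covariant2 eps /\
    td_smooth_field C /\ td_endomorphism A /\ td_endomorphism B /\
    td_connection nabla /\
    forall (f0 g0 : line_prod M -> R)
           (X Y : forall q : line_prod M, tangent (q.2 : M)),
      smooth f0 -> smooth g0 -> td_smooth_field X -> td_smooth_field Y ->
      forall q : line_prod M,
        nablahat (fun r => f0 r *: ddt r + td_lift X r)
                 (fun r => g0 r *: ddt r + td_lift Y r) q =
          (f0 q * dot_fun g0 q + td_lie X g0 q + lambda q * f0 q * g0 q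
             + g0 q * alpha q (X q) + f0 q * beta q (Y q)
             + eps q (X q) (Y q)) *: ddt q
          + td_lift (fun r => f0 r *: dot_field Y r + td_nabla nabla X Y r
                       + (f0 r * g0 r) *: C r
                       + g0 r *: A r (X r) + f0 r *: B r (Y r)) q.
Proof.
move=> /manifold_premanifold HM Hnabla; have HN := line_prod_premanifold HM.
pose ext p (v : tangent p) := sval (cid (exists_extension HM v)).
have ext_smooth p (v : tangent p) : smooth_field (ext p v).
  by have [] := svalP (cid (exists_extension HM v)).
have ext_val p (v : tangent p) : ext p v p = v.
  by have [] := svalP (cid (exists_extension HM v)).
pose hx q v := @hat_ext R n M ext q v.
have sddt := smooth_ddt HM.
have sst (E : forall p : M, tangent p) : smooth_field E ->
    td_smooth_field (still E).
  by move=> sE; exact: (td_smooth_snd HM sE).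
have slift X (sX : td_smooth_field X) := smooth_td_lift HM sX.
have lin_dd q := nabla_ext_ddt_linear HM Hnabla ext_smooth ext_val q.
have lin_ddt q := nabla_ddt_ext_linear HM Hnabla ext_smooth ext_val q.
(* The extension used inside changes with [q]; exchanging it at each [q] for the single field [E]
   exhibits the result as one value of [nablahat] on smooth fields. *)
have sXddt E : smooth_field E ->
    smooth_field (fun q => nablahat (hx q (E q.2)) (@ddt R n M) q).
  move=> sE; have := conn_smooth Hnabla (slift _ (sst _ sE)) sddt.
  congr smooth_field; apply/functional_extensionality_dep => q.
  exact: (nabla_lift_ddt HM Hnabla ext_smooth ext_val _ (sst _ sE)).
have sddtX E : smooth_field E ->
    smooth_field (fun q => nablahat (@ddt R n M) (hx q (E q.2)) q).
  move=> sE; have := conn_smooth Hnabla sddt (slift _ (sst _ sE)).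
  congr smooth_field; apply/functional_extensionality_dep => q.
  exact: (nabla_ddt_still HM Hnabla ext_smooth ext_val _ sE).
have sdd := conn_smooth Hnabla sddt sddt.
exists (fun q => lsubmx (nablahat (@ddt R n M) (@ddt R n M) q) 0 0).
exists (fun q v => lsubmx (nablahat (hx q v) (@ddt R n M) q) 0 0).
exists (fun q v => lsubmx (nablahat (@ddt R n M) (hx q v) q) 0 0).
exists (fun q v w => lsubmx (nablahat (hx q v) (hx q w) q) 0 0).
exists (fun q => rsubmx (nablahat (@ddt R n M) (@ddt R n M) q)).
exists (fun q v => rsubmx (nablahat (hx q v) (@ddt R n M) q)).
exists (fun q v => rsubmx (nablahat (@ddt R n M) (hx q v) q)).
exists (space_nabla nablahat).
split; first exact: (smooth_field_time HM sdd).
split.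
  apply: (td_form_smooth HM) => [q a v w|E sE].
    by rewrite /hx lin_dd !mxE.
  exact: (smooth_field_time HM (sXddt E sE)).
split.
  apply: (td_form_smooth HM) => [q a v w|E sE].
    by rewrite /hx lin_ddt !mxE.
  exact: (smooth_field_time HM (sddtX E sE)).
split.
  apply: (td_covariant2_smooth HM) => [q|E F sE sF].
    exact: (nabla_ext_ext_bilinear HM Hnabla ext_smooth ext_val).
  have := smooth_field_time HM
    (conn_smooth Hnabla (slift _ (sst _ sE)) (slift _ (sst _ sF))).
  congr smooth; apply/funext => q.
  by rewrite (nabla_lift_lift_time HM Hnabla ext_smooth ext_val q
    (sst _ sE) (sst _ sF)).
split; first exact: (smooth_field_space HM sdd).
split.
  apply: (td_endomorphism_smooth HM) => [q a v w|E sE].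
    by rewrite /hx lin_dd linearD/= linearZ.
  exact: (smooth_field_space HM (sXddt E sE)).
split.
  apply: (td_endomorphism_smooth HM) => [q a v w|E sE].
    by rewrite /hx lin_ddt linearD/= linearZ.
  exact: (smooth_field_space HM (sddtX E sE)).
split; first exact: (td_connection_space HM Hnabla).
move=> f0 g0 X Y sf sg sX sY q.
have sX' := slift _ sX; have sY' := slift _ sY.
have sfd := smooth_fieldZ HN sf sddt; have sgd := smooth_fieldZ HN sg sddt.
have sYh := smooth_fieldD HN sgd sY'.
have E1 := conn_addl Hnabla sfd sX' sYh q.
have E2 := conn_scalel Hnabla sf sddt sYh q.
have E3 := conn_addr Hnabla sddt sgd sY' q.
have E4 := conn_leibniz Hnabla sg sddt sddt q.
have E5 := conn_addr Hnabla sX' sgd sY' q.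
have E6 := conn_leibniz Hnabla sg sX' sddt q.
rewrite E1 E2 E3 E4 E5 E6 (lie_ddt HM) lie_td_lift.
rewrite (nabla_lift_ddt HM Hnabla ext_smooth ext_val _ sX).
rewrite (nabla_ddt_lift HM Hnabla ext_smooth ext_val _ sY).
have := nabla_lift_lift_time HM Hnabla ext_smooth ext_val q sX sY.
have := td_nabla_space HM Hnabla q sX sY.
rewrite [td_lift _ q]/td_lift => -> Ht.
(* Only the d/dt-component may be evaluated on extensions; the M-component stays, and [td_nabla] has
   already been rewritten to it. *)
rewrite [in LHS](hat_split (nablahat (td_lift X) (td_lift Y) q)) Ht.
rewrite -/(hx q (X q)) -/(hx q (Y q)).
(* With the five remaining values of [nablahat] as opaque vectors, both sides agree coordinate by
   coordinate by ring arithmetic. *)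
move: (nablahat _ _ q) (nablahat _ _ q) (nablahat _ _ q) (nablahat _ _ q)
  (nablahat _ _ q) => u1 u2 u3 u4 u5.
apply/rowP => i; case: (split_ordP i) => j ->; rewrite /ddt ?ord1.
  rewrite !(row_mxEl, mxE) eqxx mulr1n; ring.
rewrite !(row_mxEr, mxE); ring.
Qed.
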